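(* Let $v\in\mathfrak{S}_n$ be a boolean permutation and let $s$ be an optimal run word for $v$, written as a concatenation $s=r_1\cdots r_m$ of $m=\textsf{run}(v)$ runs. For each $i$, define a word $t_i$ as follows: if $r_i=a(a+1)\cdots(a+b)$ with $b>0$, let $t_i=(a+1)(a+2)\cdots(a+b)\,a\,(a+1)\cdots(a+b-1)$; if $r_i=(a+b)\cdots(a+1)a$ with $b>0$, let $t_i=(a+b-1)\cdots(a+1)a\,(a+b)\cdots(a+2)(a+1)$; if $r_i$ has a single letter, let $t_i$ be the empty word. Let $w$ be the permutation with reduced word $t_1\cdots t_m$. Then $w$ is an optimal partner for $v$, and $\textsf{ork}(v)=\ell(v)-\textsf{run}(v)$.
   Context: Permutations are composed right to left; $\sigma_i=(i,i+1)$; a word $i_1\cdots i_k$ represents $\sigma_{i_1}\cdots\sigma_{i_k}$, and it is reduced if $k$ is minimal. $\ell$ is the length function; $B(w)$ is the principal order ideal of $w$ in the Bruhat order. A permutation is boolean if its reduced words have no repeated letters. A run is a sequence of consecutive integers, either increasing or decreasing (a single letter is a run). For boolean $v$, $\textsf{run}(v)$ is the fewest number of runs whose concatenation is a reduced word for $v$, and an optimal run word for $v$ is a reduced word for $v$ that is a concatenation of $\textsf{run}(v)$ runs. For a subset $Q\subseteq\mathfrak{S}_n$ with the induced Bruhat order, an almost perfect matching of $Q$ is a chain $\emptyset=Q_0\subset Q_1\subset\cdots\subset Q_l=Q$ of coideals (upward-closed subsets) of $Q$ such that each $Q_i\setminus Q_{i-1}$ is a pair $\{x_i,y_i\}$ with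 $x_i<y_i$ and $\ell(y_i)=\ell(x_i)+1$, except for exactly one index $i$ for which $Q_i\setminus Q_{i-1}$ is a singleton $\{z\}$ (the unmatched element). For boolean $v$, the optimal rank $\textsf{ork}(v)$ is the largest value of $\ell(z)$ over all $w\in\mathfrak{S}_n$ and all almost perfect matchings of $B(v)\cap B(w)$ with unmatched element $z$; an optimal partner of $v$ is a $w$ for which $B(v)\cap B(w)$ has an almost perfect matching whose unmatched element has length $\textsf{ork}(v)$. *)

(* Defs.v *)
From mathcomp Require Import all_boot all_fingroup.
Set Implicit Arguments. Unset Strict Implicit. Unset Printing Implicit Defensive.

Local Open Scope nat_scope.

Section Defs.
Variable n : nat.
Implicit Types (u v w x y z : {perm 'I_n}) (s : seq nat).

(* simple transposition sigma_i = (i, i+1), letters i in 1..n-1,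
   acting on positions {1..n} encoded as 'I_n = {0..n-1} (position p <-> p-1) *)
Definition st (i : nat) : {perm 'I_n} :=
  match [pick x : 'I_n | val x == i.-1], [pick y : 'I_n | val y == i] with
  | Some x, Some y => if 0 < i then tperm x y else 1%g
  | _, _ => 1%g
  end.

(* the word i_1 ... i_k represents sigma_{i_1} o ... o sigma_{i_k}
   (functions composed right to left; in mathcomp (p * q) x = q (p x)) *)
Definition word_perm s : {perm 'I_n} := foldr (fun i p => (p * st i)%g) 1%g s.

Definition valid_word s := all (fun i => (0 < i) && (i < n)) s.

Definition has_word_of_size w (k : nat) : bool :=
  [exists t : k.-tuple 'I_n.-1, word_perm (map (fun i : 'I_n.-1 => (val i).+1) t) == w].

(* Coxeter length: the least k such that w is a product of k simple
   transpositions (every w has such a word of size <= n(n-1)/2 < n*n,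
   so the bounded search finds the true minimum) *)
Definition len w : nat := find (has_word_of_size w) (iota 0 (n * n)).

Definition reduced s : Prop :=
  valid_word s /\ forall t, valid_word t -> word_perm t = word_perm s -> size s <= size t.

Definition is_reduced_word_for s v : Prop := reduced s /\ word_perm s = v.

Definition boolean v : Prop := forall s, is_reduced_word_for s v -> uniq s.

Definition bruhat_step : rel {perm 'I_n} := fun x y =>
  [exists i : 'I_n, exists j : 'I_n,
     [&& i < j, y == (x * tperm i j)%g & len x < len y]].
Definition bruhat_le x y : bool := connect bruhat_step x y.
Definition bruhat_lt x y : bool := bruhat_le x y && (x != y).

Definition B w : {set {perm 'I_n}} := [set u | bruhat_le u w].

Definition inc_run s : bool := s == iota (head 0 s) (size s).
Definition dec_run s : bool := s == rev (iota (last 0 s) (size s)).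
Definition is_run s : bool := (0 < size s) && (inc_run s || dec_run s).

Definition run_decomposition (rs : seq (seq nat)) v : Prop :=
  all is_run rs /\ is_reduced_word_for (flatten rs) v.

Definition optimal_run_decomposition (rs : seq (seq nat)) v : Prop :=
  run_decomposition rs v /\
  forall rs', run_decomposition rs' v -> size rs <= size rs'.

Definition coideal (Q A : {set {perm 'I_n}}) : bool :=
  (A \subset Q) && [forall x in A, forall y in Q, bruhat_le x y ==> (y \in A)].

Definition prefix_union (bs : seq {set {perm 'I_n}}) (k : nat) : {set {perm 'I_n}} :=
  \bigcup_(b <- take k bs) b.

Definition matched_pair (b : {set {perm 'I_n}}) : Prop :=
  exists x y, b = [set x; y] /\ bruhat_lt x y /\ len y = (len x).+1.

(* almost perfect matching of Q with unmatched element z, given by the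
   successive differences bs_i = Q_i \ Q_{i-1} of the chain of coideals
   Q_0 = set0 subset Q_1 subset ... subset Q_l = Q *)
Definition almost_perfect_matching (Q : {set {perm 'I_n}})
    (bs : seq {set {perm 'I_n}}) z : Prop :=
  prefix_union bs (size bs) = Q /\
  (forall k, k < size bs -> coideal Q (prefix_union bs k.+1)) /\
  (forall k, k < size bs -> [disjoint nth set0 bs k & prefix_union bs k]) /\
  exists i, i < size bs /\ nth set0 bs i = [set z] /\
    forall j, j < size bs -> j != i -> matched_pair (nth set0 bs j).

Definition has_apm_with_unmatched (Q : {set {perm 'I_n}}) z : Prop :=
  exists bs, almost_perfect_matching Q bs z.

Definition is_ork v (k : nat) : Prop :=
  (exists w z, has_apm_with_unmatched (B v :&: B w) z /\ len z = k) /\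
  (forall w z, has_apm_with_unmatched (B v :&: B w) z -> len z <= k).

Definition optimal_partner v w : Prop :=
  exists k, is_ork v k /\
    exists z, has_apm_with_unmatched (B v :&: B w) z /\ len z = k.

End Defs.

Definition tword (r : seq nat) : seq nat :=
  if size r <= 1 then [::]
  else if inc_run r then
    let a := head 0 r in let b := (size r).-1 in
    iota a.+1 b ++ a :: iota a.+1 b.-1
  else
    let a := last 0 r in let b := (size r).-1 in
    rev (iota a b) ++ rev (iota a.+1 b).

(* Main.v *)
(* The ideal B(v) is the Boolean lattice of subwords of a reduced word s of v, so
   B(v) :&: B(w) is the face poset of a simplicial complex on the letters of s, and
   an almost perfect matching of it is a sequence of elementary collapses with one
   critical face z. Such a complex has nonzero mod 2 homology in the degree of z.
   By the rank matrix criterion for the Bruhat order, the minimal nonfaces are runs.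
   As in Taylor's resolution, homology in degree j forces the letters to be covered
   by len v - j nonfaces, and a cover of the letters by k runs can be trimmed to a
   decomposition of v into at most k runs; hence len z <= len v - run v.
   For the word t_1 ... t_m, which is reduced because the t_i have disjoint
   supports, the minimal nonfaces are exactly the runs r_i, so the complex is a
   join of boundaries of simplices. Toggling one letter of each run matches all
   faces but one, which has len v - m letters. *)
Require Import Defs.
From mathcomp Require Import all_boot all_fingroup.
From mathcomp Require Import zify.
Set Implicit Arguments. Unset Strict Implicit. Unset Printing Implicit Defensive.

(** * Inversions and reduced words *)

(** Why nonfaces come from runs: for i <= j the rank entry (i, j) of a boolean v is 0 or 1, so where
    v exceeds w it is 1 against 0. A positive entry forces the subword j ... i into every word of
    the permutation, and this subword alone makes the entry positive. Entries with i > j are treated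
    by passing to inverses, which produces increasing runs. Why the critical face is seen by
    homology: attaching or removing a matched pair preserves exactness in each degree, while a
    single face attached to an acyclic complex creates a cycle that no larger face can fill. The
    identity is an element of the ideal, so the empty face has to count; then degree is Coxeter
    length. The count is exact: a critical face in degree j yields exactly [len v - j] covering
    runs. They may overlap, which is why they must still be trimmed before they can be compared with
    the run number. *)

Section SymmetricGroup.
Variable n : nat.
Implicit Types (p q u v w x y : {perm 'I_n}) (a b i j k l : 'I_n).

Lemma st_tperm c : 0 < c < n ->
  exists a b : 'I_n, [/\ a = c.-1 :> nat, b = c :> nat & st n c = tperm a b].
Proof.
case/andP=> c0 cn; rewrite /st.
case: pickP => [a /eqP Ha|/(_ (Ordinal (leq_ltn_trans (leq_pred c) cn)))]; last by rewrite eqxx.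
case: pickP => [b /eqP Hb|/(_ (Ordinal cn))]; last by rewrite eqxx.
by rewrite c0; exists a, b.
Qed.

Lemma st_out c : ~~ (0 < c < n) -> st n c = 1%g.
Proof.
move=> H; rewrite /st; case: pickP => // a _; case: pickP => // b /eqP Hb.
by case: ifP => // c0; move: H; rewrite c0 -Hb ltn_ord.
Qed.

Lemma stK c : (st n c * st n c = 1)%g.
Proof.
case: (boolP (0 < c < n)) => [/st_tperm [a [b [_ _ ->]]]|/st_out ->].
  exact: tperm2.
by rewrite mulg1.
Qed.

Lemma stV c : (st n c)^-1%g = st n c.
Proof. by apply/eqP; rewrite eq_invg_mul stK. Qed.

Lemma val_st c (a : 'I_n) : 0 < c < n ->
  st n c a = (if a == c.-1 :> nat then c else if a == c :> nat then c.-1 else a) :> nat.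
Proof.
move=> Hc; have [x [y [Hx Hy ->]]] := st_tperm Hc.
case: tpermP => [->|->|/eqP H1 /eqP H2]; [| |rewrite -!val_eqE /= in H1 H2];
  do ![case: eqP]; lia.
Qed.

Lemma st_ltn c d (a : 'I_n) : c != d -> (st n c a < d) = (a < d).
Proof.
move=> cd; case: (boolP (0 < c < n)) => [Hc|/st_out ->]; last by rewrite perm1.
rewrite (val_st a Hc); do ![case: eqP]; lia.
Qed.

Lemma word_perm_cat s t : word_perm n (s ++ t) = (word_perm n t * word_perm n s)%g.
Proof. by elim: s => [|c s IH] /=; rewrite ?mulg1 // IH mulgA. Qed.

Lemma word_perm_rev s : word_perm n (rev s) = (word_perm n s)^-1%g.
Proof.
elim: s => [|c s IH] /=; first by rewrite invg1.
by rewrite rev_cons -cats1 word_perm_cat /= mul1g IH invMg stV.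
Qed.

Lemma word_perm_ltn s d (a : 'I_n) : d \notin s -> (word_perm n s a < d) = (a < d).
Proof.
elim: s a => [|c s IH] a /=; first by rewrite perm1.
rewrite inE negb_or => /andP[dc ds].
by rewrite permM st_ltn 1?eq_sym // IH.
Qed.

Lemma word_permV_ltn s d (a : 'I_n) :
  d \notin s -> ((word_perm n s)^-1%g a < d) = (a < d).
Proof. by move=> ds; rewrite -word_perm_rev word_perm_ltn // mem_rev. Qed.

(* Inversions are counted by values, because both words and Bruhat steps act
   on values ([x * tperm i j] applies [x] first). *)
Definition Inv p : {set 'I_n * 'I_n} :=
  [set ab : 'I_n * 'I_n | (ab.1 < ab.2) && ((p^-1)%g ab.2 < (p^-1)%g ab.1)].
Definition ninv p := #|Inv p|.

Lemma in_Inv p i j : ((i, j) \in Inv p) = (i < j) && ((p^-1)%g j < (p^-1)%g i).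
Proof. by rewrite inE. Qed.

Lemma tpermMV p (a b z : 'I_n) : ((p * tperm a b)^-1)%g z = (p^-1)%g (tperm a b z).
Proof. by rewrite invMg tpermV permM. Qed.

Lemma ninv1 : ninv 1%g = 0.
Proof.
apply/eqP; rewrite cards_eq0 -subset0; apply/subsetP => -[a b].
by rewrite !inE invg1 !perm1 /=; lia.
Qed.

Lemma ninv_bound p : 0 < n -> ninv p < n * n.
Proof.
move=> n0; have <- : #|{: 'I_n * 'I_n}| = n * n by rewrite card_prod card_ord.
rewrite -cardsT; apply: proper_card; apply/properP; split=> //.
by exists (Ordinal n0, Ordinal n0); rewrite !inE // ltnn.
Qed.

(** An adjacent swap keeps the order of every pair of values except its own, so relabelling by it
    carries the old inversions to new ones, and only [(a, b)] is added. *)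
Lemma ninvM_adj p (a b : 'I_n) : b = a.+1 :> nat -> (p^-1)%g a < (p^-1)%g b ->
  ninv (p * tperm a b)%g = (ninv p).+1.
Proof.
move=> ab lt.
pose s := tperm a b; pose g (ij : 'I_n * 'I_n) := (s ij.1, s ij.2).
have gK : involutive g by move=> [i j]; rewrite /g /= !tpermK.
have gmem ij : (ij \in g @: Inv p) = (g ij \in Inv p).
  by rewrite -{1}(gK ij) mem_imset //; apply: inv_inj.
have -> : ninv (p * tperm a b)%g = #|(a, b) |: g @: Inv p|.
  rewrite /ninv; congr #|pred_of_set _|; apply/setP => -[i j].
  rewrite in_setU1 gmem !in_Inv !tpermMV xpair_eqE /s.
  case: tpermP => [->|->|/eqP i1 /eqP i2]; case: tpermP => [->|->|/eqP j1 /eqP j2];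
    try (rewrite -!val_eqE /= in i1 i2); try (rewrite -!val_eqE /= in j1 j2);
    rewrite -?val_eqE /=; move: ab lt => /=; lia.
have /negbTE Nab : (a, b) \notin g @: Inv p.
  by rewrite gmem in_Inv /s tpermL tpermR ab ltnNge leqnSn.
by rewrite cardsU1 Nab card_imset //; apply: inv_inj.
Qed.

Lemma ninvM_adj_desc p (a b : 'I_n) : b = a.+1 :> nat -> (p^-1)%g b < (p^-1)%g a ->
  ninv p = (ninv (p * tperm a b)%g).+1.
Proof.
move=> ab lt; rewrite -(ninvM_adj ab); first by rewrite -mulgA tperm2 mulg1.
by rewrite !tpermMV tpermL tpermR.
Qed.

(* [(a b) = (a a+1)(a+1 b)(a a+1)]; the two outer factors change [ninv] by one
   and cannot both decrease it. *)
Lemma ninv_tperm p (a b : 'I_n) : a < b -> (p^-1)%g a < (p^-1)%g b ->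
  ninv p < ninv (p * tperm a b)%g.
Proof.
move: {2}(b - a) (leqnn (b - a)) => m; elim: m p a b => [|m IH] p a b; first by lia.
move=> le_m ab lt.
case: (eqVneq (b : nat) a.+1) => [ba|ba]; first by rewrite ninvM_adj.
have a1n : a.+1 < n by have := ltn_ord b; lia.
have [c ca] : exists c : 'I_n, c = a.+1 :> nat by exists (Ordinal a1n).
have Dac : a != c by rewrite -val_eqE /=; lia.
have Dbc : b != c by rewrite -val_eqE /=; lia.
have Dab : a != b by rewrite -val_eqE /=; lia.
have E : (tperm a b = tperm a c * tperm c b * tperm a c)%g.
  have <- : (tperm c b ^ tperm a c)%g = tperm a b.
    by rewrite tpermJ tpermR tpermD // eq_sym.
  by rewrite conjgE tpermV mulgA.
pose p1 := (p * tperm a c)%g; pose p2 := (p1 * tperm c b)%g.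
have -> : (p * tperm a b)%g = (p2 * tperm a c)%g by rewrite E /p2 /p1 !mulgA.
have V1 z : (p1^-1)%g z = (p^-1)%g (tperm a c z) by exact: tpermMV.
have V2 z : (p2^-1)%g z = (p1^-1)%g (tperm c b z) by exact: tpermMV.
have H2 : ninv p1 < ninv p2.
  by apply: IH; rewrite ?V1 ?tpermR ?tpermD // 1?eq_sym //; lia.
have neq z t : z != t -> (p^-1)%g z != (p^-1)%g t :> nat.
  by rewrite (inj_eq val_inj) (inj_eq perm_inj).
have V2a : (p2^-1)%g a = (p^-1)%g c by rewrite V2 tpermD ?V1 ?tpermL // eq_sym.
have V2c : (p2^-1)%g c = (p^-1)%g b by rewrite V2 tpermL V1 tpermD // eq_sym.
have asc2 := @ninvM_adj p2 a c ca; have desc2 := @ninvM_adj_desc p2 a c ca.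
rewrite V2a V2c in asc2 desc2.
have := neq _ _ Dac; rewrite neq_ltn => /orP [] H1.
  have := ninvM_adj ca H1; rewrite -/p1 => I1.
  have := neq _ _ Dbc; rewrite neq_ltn => /orP [/desc2|/asc2]; lia.
have := ninvM_adj_desc ca H1; rewrite -/p1 => I1.
have := asc2 (ltn_trans H1 lt); lia.
Qed.

Lemma ninv_tpermE p (a b : 'I_n) : a < b ->
  (ninv p < ninv (p * tperm a b)%g) = ((p^-1)%g a < (p^-1)%g b).
Proof.
move=> ab; apply/idP/idP; last exact: ninv_tperm.
apply: contraTT; rewrite -leqNgt leq_eqVlt => /orP [/eqP/val_inj/perm_inj E|lt].
  by move: ab; rewrite E ltnn.
rewrite -leqNgt; apply: ltnW.
rewrite -[X in _ < ninv X](mulgK (tperm a b)) tpermV.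
by apply: ninv_tperm => //; rewrite !tpermMV tpermL tpermR.
Qed.

Lemma perm_ge_id q : (forall a, a <= q a) -> q = 1%g.
Proof.
move=> H; apply/permP => a; rewrite perm1.
have [m] := ubnP (val a); elim: m a => // m IH a lt_m.
have := H ((q^-1)%g a); rewrite permKV leq_eqVlt => /orP [/eqP/val_inj E|lt].
  by rewrite -{1}E permKV.
have := IH _ (leq_trans lt lt_m); rewrite permKV => E.
by rewrite -E ltnn in lt.
Qed.

(** Without a descent [p^-1] is increasing, hence moves no value down, and [perm_ge_id] applies. *)
Lemma exists_descent p : p != 1%g ->
  exists a b : 'I_n, b = a.+1 :> nat /\ (p^-1)%g b < (p^-1)%g a.
Proof.
move=> p1; case: (pickP (fun ab : 'I_n * 'I_n =>
  (ab.2 == ab.1.+1 :> nat) && ((p^-1)%g ab.2 < (p^-1)%g ab.1))).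
  by move=> [a b] /= /andP [/eqP H1 H2]; exists a, b.
move=> H; case/eqP: p1; apply: invg_inj; rewrite invg1; apply: perm_ge_id => a.
case: a => m; elim: m => // m IH Hm.
have := H (Ordinal (ltnW Hm), Ordinal Hm); rewrite /= eqxx /= => /negbT.
have := IH (ltnW Hm) => /= H1; rewrite -leqNgt leq_eqVlt => /orP [/eqP/val_inj/perm_inj []|].
  by move/eqP; rewrite ltn_eqF.
exact: leq_ltn_trans H1.
Qed.

Lemma ninv_st_asc p c (a b : 'I_n) : a = c.-1 :> nat -> b = c :> nat -> 0 < c ->
  (p^-1)%g a < (p^-1)%g b -> ninv (p * st n c)%g = (ninv p).+1.
Proof.
move=> Ha Hb c0 lt; have cn : 0 < c < n by rewrite c0 -Hb ltn_ord.
have [a' [b' [Ha' Hb' ->]]] := st_tperm cn.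
have Ea : a' = a by apply: val_inj; rewrite /= Ha Ha'.
have Eb : b' = b by apply: val_inj; rewrite /= Hb Hb'.
by subst; apply: ninvM_adj => //; lia.
Qed.

Lemma ninv_st_le p c : ninv (p * st n c)%g <= (ninv p).+1.
Proof.
case: (boolP (0 < c < n)) => [Hc|/st_out ->]; last by rewrite mulg1 leqnSn.
have [a [b [Ha Hb ->]]] := st_tperm Hc.
have ab : b = a.+1 :> nat by lia.
have : (p^-1)%g a != (p^-1)%g b :> nat.
  by rewrite (inj_eq val_inj) (inj_eq perm_inj) -val_eqE /=; lia.
rewrite neq_ltn => /orP [] lt; first by rewrite ninvM_adj.
by rewrite (ninvM_adj_desc ab lt); lia.
Qed.

Lemma ninv_word_le s : ninv (word_perm n s) <= size s.
Proof.
elim: s => [|c s IH] /=; first by rewrite ninv1.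
exact: leq_trans (ninv_st_le _ _) _.
Qed.

Lemma exists_word p : exists2 s, valid_word n s & word_perm n s = p /\ size s = ninv p.
Proof.
have [m] := ubnP (ninv p); elim: m p => // m IH p lt_m.
case: (eqVneq p 1%g) => [->|p1]; first by exists [::]; rewrite ?ninv1.
have [a [b [ab lt]]] := exists_descent p1.
have E := ninvM_adj_desc ab lt.
case: (IH (p * tperm a b)%g); first by lia.
have Hb : 0 < b < n by rewrite ltn_ord ab.
move=> s vs [ws ss]; exists ((b : nat) :: s); first by rewrite /= vs Hb.
rewrite /= ss -E; split => //; rewrite ws.
have [a' [b' [Ha' Hb' ->]]] := st_tperm Hb.
have -> : a' = a by apply: val_inj; rewrite /= Ha' ab.
have -> : b' = b by apply: val_inj; rewrite /= Hb'.
by rewrite -mulgA tperm2 mulg1.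
Qed.

Lemma valid_word_tuple s : valid_word n s ->
  exists t : (size s).-tuple 'I_n.-1, map (fun i : 'I_n.-1 => (val i).+1) t = s.
Proof.
elim: s => [|c s IH] /=; first by exists [tuple].
case/andP => /andP [c0 cn] /IH [t Ht].
have cn' : c.-1 < n.-1 by lia.
by exists [tuple of Ordinal cn' :: t]; rewrite /= Ht prednK.
Qed.

Lemma lenE p : len p = ninv p.
Proof.
have [s vs [ws ss]] := exists_word p.
have [t Ht] := valid_word_tuple vs.
(* For [n = 0] the search range is empty and [find] returns 0, the right value; for [n > 0] the
   range contains [ninv p] by [ninv_bound]. *)
case: (posnP n) => [n0|n0].
  have -> : ninv p = 0.
    by apply/eqP; rewrite cards_eq0 -subset0; apply/subsetP => -[[a Ha]]; lia.
  by rewrite /len; have -> : n * n = 0 by rewrite n0.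
have Hp : has_word_of_size p (ninv p).
  by rewrite -ss; apply/existsP; exists t; rewrite Ht ws.
have Hs : has (has_word_of_size p) (iota 0 (n * n)).
  by apply/hasP; exists (ninv p); rewrite // mem_iota /= ninv_bound.
apply/eqP; rewrite eqn_leq; apply/andP; split.
  rewrite leqNgt; apply/negP => lt.
  by have := before_find 0 lt; rewrite nth_iota ?ninv_bound // add0n Hp.
have := Hs; rewrite has_find size_iota => lt.
have := nth_find 0 Hs; rewrite nth_iota // add0n.
rewrite -/(len p) {1}/has_word_of_size => /existsP [t' /eqP E].
have := ninv_word_le [seq (val i).+1 | i : 'I_n.-1 <- t'].
by rewrite E size_map size_tuple.
Qed.

Lemma len_tperm p (a b : 'I_n) : a < b ->
  (len p < len (p * tperm a b)%g) = ((p^-1)%g a < (p^-1)%g b).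
Proof. by move=> ab; rewrite !lenE ninv_tpermE. Qed.

Lemma reducedP s : valid_word n s -> reduced n s <-> size s = len (word_perm n s).
Proof.
move=> vs; rewrite lenE; split=> [[_ H]|E].
  have [t vt [wt st]] := exists_word (word_perm n s).
  by apply/eqP; rewrite eqn_leq ninv_word_le andbT -st H.
split=> // t vt wt; rewrite E -wt; exact: ninv_word_le.
Qed.

Lemma lenV p : len (p^-1)%g = len p.
Proof.
rewrite !lenE.
suff H q : ninv (q^-1)%g <= ninv q by apply/eqP; rewrite eqn_leq H -{1}(invgK p) H.
have [s _ [<- <-]] := exists_word q.
by rewrite -word_perm_rev; apply: leq_trans (ninv_word_le _) _; rewrite size_rev.
Qed.

End SymmetricGroup.

(** * Bruhat order, rank matrices and runs *)

Section BruhatOrder.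
Variable n : nat.
Implicit Types (p q u v w x y : {perm 'I_n}) (a b k l : 'I_n).

Lemma bruhat_refl x : bruhat_le x x. Proof. exact: connect0. Qed.

Lemma bruhat_trans y x z : bruhat_le x y -> bruhat_le y z -> bruhat_le x z.
Proof. exact: connect_trans. Qed.

Lemma bruhat_stepP x y :
  reflect (exists a b, [/\ a < b, y = (x * tperm a b)%g & (x^-1)%g a < (x^-1)%g b])
          (bruhat_step x y).
Proof.
apply: (iffP existsP) => [[a /existsP [b /and3P [ab /eqP -> lt]]]|[a [b [ab -> lt]]]].
  by exists a, b; rewrite -len_tperm.
by exists a; apply/existsP; exists b; rewrite ab eqxx len_tperm.
Qed.

Lemma bruhat_tperm x (a b : 'I_n) :
  len x < len (x * tperm a b)%g -> bruhat_le x (x * tperm a b)%g.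
Proof.
move=> lt; case: (ltngtP a b) => [ab|ba|/val_inj E].
- by apply/connect1/bruhat_stepP; exists a, b; rewrite -len_tperm.
- rewrite tpermC in lt *.
  by apply/connect1/bruhat_stepP; exists b, a; rewrite -len_tperm.
- by rewrite E tperm1 mulg1 ltnn in lt.
Qed.

Lemma bruhat_st x c : len x < len (x * st n c)%g -> bruhat_le x (x * st n c)%g.
Proof.
case: (boolP (0 < c < n)) => [/st_tperm [a [b [_ _ ->]]]|/st_out ->].
  exact: bruhat_tperm.
by rewrite mulg1 ltnn.
Qed.

Lemma bruhat_ind_l (P : {perm 'I_n} -> Prop) y :
  P y -> (forall x x1, bruhat_step x x1 -> bruhat_le x1 y -> P x1 -> P x) ->
  forall x, bruhat_le x y -> P x.
Proof.
move=> Py Pstep x /connectP [s]; elim: s x => [|z s IH] x /=; first by move=> _ <-.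
move=> /andP [xz zs] E; apply: (Pstep _ z) => //; last exact: IH.
by apply/connectP; exists s.
Qed.

(** A transposition on the values of [x] is one on the positions of [x^-1], and conjugation by [x]
    moves it back to the values. *)
Lemma bruhat_leV x y : bruhat_le x y -> bruhat_le (x^-1)%g (y^-1)%g.
Proof.
move: x; apply: bruhat_ind_l => [|x x1 /bruhat_stepP [a [b [ab -> lt]]] _]; first exact: bruhat_refl.
apply: bruhat_trans.
have -> : ((x * tperm a b)^-1 = x^-1 * tperm ((x^-1)%g a) ((x^-1)%g b))%g.
  by rewrite -tpermJ invMg tpermV conjgE invgK !mulgA mulVg mul1g.
apply: bruhat_tperm; rewrite len_tperm // invgK; by rewrite !permKV.
Qed.

Lemma bruhat_leVE x y : bruhat_le (x^-1)%g (y^-1)%g = bruhat_le x y.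
Proof. by apply/idP/idP => /bruhat_leV //; rewrite !invgK. Qed.

Lemma st_mono c (a b : 'I_n) : a < b -> tperm a b != st n c -> st n c a < st n c b.
Proof.
move=> ab; case: (boolP (0 < c < n)) => [Hc|/st_out ->]; last by rewrite !perm1.
move=> ne; have [/andP [/eqP Ea /eqP Eb]|H] := boolP ((a == c.-1 :> nat) && (b == c :> nat)).
  have [a0 [b0 [H1 H2 E]]] := st_tperm Hc; case/eqP: ne; rewrite E.
  by congr tperm; apply: val_inj; rewrite /= ?H1 ?H2.
rewrite !val_st //; move: H; do ![case: eqP]; lia.
Qed.

Lemma stMV p c (a : 'I_n) : ((p * st n c)^-1)%g (st n c a) = (p^-1)%g a.
Proof. by apply: (canLR (permK _)); rewrite permM permKV. Qed.

(** Conjugation by [st n c] turns [tperm a b] into the transposition of the images, still in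
    ascending order unless [tperm a b] is [st n c]; in that case [x * st n c] is [y]. *)
Lemma lifting_step x y c : bruhat_step x y ->
  bruhat_le (x * st n c)%g y \/ bruhat_le (x * st n c)%g (y * st n c)%g.
Proof.
case/bruhat_stepP => a [b [ab -> lt]].
case: (eqVneq (tperm a b) (st n c)) => [->|ne]; [left; exact: bruhat_refl|right].
have -> : (x * tperm a b * st n c = x * st n c * tperm (st n c a) (st n c b))%g.
  by rewrite -tpermJ conjgE stV -!mulgA (mulgA (st n c)) stK mul1g.
apply: bruhat_tperm; rewrite len_tperm; last exact: st_mono.
by rewrite !stMV.
Qed.

Lemma lifting x y c : bruhat_le x y ->
  bruhat_le (x * st n c)%g y \/ bruhat_le (x * st n c)%g (y * st n c)%g.
Proof.
move: x; apply: bruhat_ind_l => [|x x1 st1 le1]; first by right; apply: bruhat_refl.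
case: (lifting_step c st1) => H1; first by move=> _; left; apply: bruhat_trans le1.
by case=> H2; [left|right]; apply: bruhat_trans H2.
Qed.

Lemma lifting_up x y c : bruhat_le x y -> len y < len (y * st n c)%g ->
  bruhat_le (x * st n c)%g (y * st n c)%g.
Proof.
by move=> xy lt; case: (lifting c xy) => // H; apply: bruhat_trans H (bruhat_st lt).
Qed.

Lemma subword_le s t : size t = len (word_perm n t) -> subseq s t ->
  bruhat_le (word_perm n s) (word_perm n t).
Proof.
elim: t s => [|c t IH] s; first by move=> _; rewrite subseq0 => /eqP ->; apply: bruhat_refl.
move=> /= St.
have E : size t = len (word_perm n t) /\ len (word_perm n t) < len (word_perm n t * st n c)%g.
  by have := ninv_st_le (word_perm n t) c; have := ninv_word_le n t; rewrite -!lenE; lia.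
case: E => E lt.
have H s' : subseq s' t -> bruhat_le (word_perm n s') (word_perm n t * st n c)%g.
  by move=> /(IH _ E) le; apply: bruhat_trans le (bruhat_st lt).
case: s => [|d s] /=; first by move=> _; apply: (H [::]); apply: sub0seq.
by case: eqP => [-> /(IH _ E) le|_ /H]; first exact: lifting_up.
Qed.

(** The transposition is pushed through the word from the left, conjugated by each letter it passes,
    until it equals a letter, which is deleted. It must meet one: otherwise the inversion would
    survive down to the empty word. *)
Lemma strong_exchange s (a b : 'I_n) :
  a < b -> ((word_perm n s)^-1)%g b < ((word_perm n s)^-1)%g a ->
  exists2 s', subseq s' s & word_perm n s' = (word_perm n s * tperm a b)%g.
Proof.
elim: s a b => [|c s IH] a b ab /=; first by rewrite invg1 !perm1; lia.
rewrite invMg stV !permM => lt.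
case: (eqVneq (tperm a b) (st n c)) => [->|ne].
  by exists s; [exact: subseq_cons|rewrite -mulgA stK mulg1].
have [s' ss' ws'] := IH _ _ (st_mono ab ne) lt.
exists (c :: s'); rewrite /= ?eqxx // ws' -tpermJ conjgE stV.
by rewrite -!mulgA stK mulg1.
Qed.

Lemma le_subword s x : bruhat_le x (word_perm n s) ->
  exists2 s', subseq s' s & word_perm n s' = x.
Proof.
move: x; apply: bruhat_ind_l => [|x x1 /bruhat_stepP [a [b [ab E lt]]] _ [s' ss' ws']].
  by exists s.
have := @strong_exchange s' a b ab; rewrite ws' E !tpermMV tpermL tpermR => /(_ lt) [s1 s11 w1].
exists s1; first exact: subseq_trans s11 ss'.
by rewrite w1 -mulgA tperm2 mulg1.
Qed.

(** The rank matrix of the Bruhat order, counting a corner of the permutation matrix. With positions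
    and values starting at 0, the letter [j] is the only one that affects column [j]. *)
Definition Rk p (i j : nat) := #|[set k : 'I_n | (k < i) && (j <= p k)]|.

Lemma Rk_gt0P p i j : reflect (exists2 k : 'I_n, k < i & j <= p k) (0 < Rk p i j).
Proof.
apply: (iffP card_gt0P) => [[k]|[k k1 k2]]; first by rewrite inE => /andP []; exists k.
by exists k; rewrite inE k1.
Qed.

(** Monotonicity for positivity suffices, since [Rk_word_le] bounds by 1 the entries with [i <= j]
    of a word without repetitions. *)
Lemma bruhat_Rk_gt0 x y i j : bruhat_le x y -> 0 < Rk x i j -> 0 < Rk y i j.
Proof.
move: x; apply: bruhat_ind_l => // x x1 /bruhat_stepP [a [b [ab -> lt]]] _ IH.
move=> /Rk_gt0P [k k1 k2]; apply: IH; apply/Rk_gt0P.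
case: (eqVneq (x k) a) => [E|Na]; first by exists k; rewrite // permM E tpermL; rewrite E in k2; lia.
case: (eqVneq (x k) b) => [E|Nb].
  exists ((x^-1)%g a); last by rewrite permM permKV tpermL -E.
  by apply: ltn_trans k1; apply: leq_trans lt _; rewrite -E permK.
by exists k; rewrite // permM tpermD // eq_sym.
Qed.

Lemma Rk_st p c i j : c != j -> Rk (p * st n c)%g i j = Rk p i j.
Proof.
move=> cj; apply: eq_card => k; rewrite !inE permM.
by rewrite !(leqNgt j) st_ltn.
Qed.

Lemma Rk_col p i (a : 'I_n) : Rk p i a = ((p^-1)%g a < i) + Rk p i a.+1.
Proof.
rewrite /Rk (cardD1 ((p^-1)%g a)) inE permKV leqnn andbT; congr (_ + _).
apply: eq_card => k; rewrite !inE -(inj_eq (@perm_inj _ p)) permKV.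
by rewrite -val_eqE /= andbCA; congr (_ && _); lia.
Qed.

Lemma Rk_swap p i (a b : 'I_n) : b = a.+1 :> nat ->
  Rk (p * tperm a b)%g i b = ((p^-1)%g a < i) + Rk p i b.+1.
Proof.
move=> ab; rewrite Rk_col tpermMV tpermR; congr (_ + _).
apply: eq_card => k; rewrite !inE permM.
by case: tpermP => [->|->|//]; rewrite ab; lia.
Qed.

Lemma Rk_id_le x : (forall i, Rk x i i = 0) -> x = 1%g.
Proof.
move=> H; apply: invg_inj; rewrite invg1; apply: perm_ge_id => a.
rewrite leqNgt; apply/negP => lt.
have := H a; apply/eqP; rewrite -lt0n; apply/Rk_gt0P.
by exists ((x^-1)%g a); rewrite ?permKV.
Qed.

Lemma Rk1 i j : i <= j -> Rk 1 i j = 0.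
Proof.
by move=> ij; apply/eqP; rewrite -leqn0 leqNgt; apply/Rk_gt0P => -[k]; rewrite perm1; lia.
Qed.

Lemma Rk_anti p i j j' : j <= j' -> Rk p i j' <= Rk p i j.
Proof.
move=> jj; apply: subset_leq_card; apply/subsetP => k; rewrite !inE => /andP [-> /=].
exact: leq_trans.
Qed.

(* Swapping two adjacent values [a, a+1] in descending position changes only
   the column [a+1] of the rank matrix, so a descent of [y] can be removed from
   [y], and simultaneously from [x] when [x] has it. *)
Lemma tableau_criterion x y : (forall i j, i <= n -> j <= n -> Rk x i j <= Rk y i j) ->
  bruhat_le x y.
Proof.
have [m] := ubnP (ninv y); elim: m x y => // m IH x y lt_m H.
case: (eqVneq y 1%g) => [E|/exists_descent [a [b [ab lt]]]].
  rewrite (_ : x = y) ?bruhat_refl // E; apply: Rk_id_le => i.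
  have [le_in|lt_ni] := leqP i n.
    by apply/eqP; rewrite -leqn0; apply: leq_trans (H _ _ le_in le_in) _; rewrite E Rk1.
  apply/eqP; rewrite -leqn0 leqNgt; apply/Rk_gt0P => -[k _].
  by have := ltn_ord (x k); lia.
pose s := st n b; have Hs : s = tperm a b.
  have Hb : 0 < b < n by rewrite ltn_ord ab.
  have [a' [b' [Ha' Hb' E]]] := st_tperm Hb.
  by rewrite /s E; congr tperm; apply: val_inj; rewrite /= ?Ha' ?Hb' ?ab.
have inv_y : ninv y = (ninv (y * s)%g).+1 by rewrite Hs; apply: ninvM_adj_desc.
have IHy x' : (forall i j, i <= n -> j <= n -> Rk x' i j <= Rk (y * s)%g i j) -> bruhat_le x' (y * s)%g.
  by apply: IH; rewrite -ltnS -inv_y.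
have yE : (y * s * s)%g = y by rewrite -mulgA stK mulg1.
have up : len (y * s)%g < len (y * s * s)%g by rewrite yE !lenE; lia.
have R_ys i j : Rk (y * s)%g i j = if j == b then ((y^-1)%g a < i) + Rk y i b.+1 else Rk y i j.
  case: eqP => [->|/eqP jb]; first by rewrite Hs Rk_swap.
  by rewrite Rk_st // eq_sym.
have col p i : Rk p i a = ((p^-1)%g a < i) + (((p^-1)%g b < i) + Rk p i b.+1).
  by rewrite Rk_col -ab Rk_col.
have [lex|ltx] := leqP ((x^-1)%g a) ((x^-1)%g b).
  rewrite -yE; apply: bruhat_trans (bruhat_st up).
  apply: IHy => i j le_i le_j; rewrite R_ys; case: eqP => [->|_]; last exact: H.
  have := H i a le_i (ltnW (ltn_ord a)); have := H i b le_i (ltnW (ltn_ord b)).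
  have := H i b.+1 le_i (ltn_ord b).
  rewrite !col !(Rk_col _ _ b); lia.
have xE : (x * s * s)%g = x by rewrite -mulgA stK mulg1.
rewrite -yE -xE; apply: lifting_up up; apply: IHy => i j le_i le_j; rewrite R_ys.
case: eqP => [->|/eqP jb]; last by rewrite Rk_st 1?eq_sym // H.
have := H i a le_i (ltnW (ltn_ord a)); have := H i b.+1 le_i (ltn_ord b).
rewrite Hs Rk_swap // !col; lia.
Qed.

(** The complementary corner, positions below [i] with values below [j], has the same size for [p]
    and [p^-1]. This carries entries below the diagonal above it. *)
Lemma Rk_inv p i j : i <= n -> j <= n -> Rk p i j + j = Rk (p^-1)%g j i + i.
Proof.
have card_lt m : m <= n -> #|[set k : 'I_n | k < m]| = m.
  by move=> mn; rewrite -sum1dep_card -(big_ord_widen n (fun=> 1)) // sum1_card card_ord.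
move=> le_i le_j.
have Ei := cardsID [set k : 'I_n | j <= p k] [set k : 'I_n | k < i].
have Ej := cardsID [set k : 'I_n | i <= (p^-1)%g k] [set k : 'I_n | k < j].
rewrite card_lt // -setIdE in Ei; rewrite card_lt // -setIdE in Ej.
have E : #|[set k : 'I_n | k < j] :\: [set k | i <= (p^-1)%g k]| =
          #|[set k : 'I_n | k < i] :\: [set k | j <= p k]|.
  transitivity #|p @: ([set k : 'I_n | k < i] :\: [set k | j <= p k])|.
    apply: eq_card => k; rewrite -[in RHS](permKV p k) mem_imset; last exact: perm_inj.
    by rewrite !inE permKV -!ltnNge andbC.
  by rewrite card_imset //; apply: perm_inj.
have RE q (a b : nat) : Rk q a b = #|[set k in [set k : 'I_n | k < a] | b <= q k]|.
  by apply: eq_card => k; rewrite !inE.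
by rewrite !RE -[X in _ + X = _]Ej -[X in _ = _ + X]Ei E addnCA.
Qed.

Lemma Rk_word_le s i j : i <= j -> Rk (word_perm n s) i j <= count_mem i s.
Proof.
move=> ij; apply: leq_trans (Rk_anti _ _ ij) _ => {j ij}.
elim: s => [|c s IH] /=; first by rewrite Rk1.
case: eqP => [->|/eqP ci]; last by rewrite Rk_st.
apply: (@leq_trans (1 + Rk (word_perm n s) i i)); last by rewrite leq_add2l.
case: (boolP (0 < i < n)) => [Hi|/st_out ->]; last by rewrite mulg1 leqW.
have [a [b [Ha Hb ->]]] := st_tperm Hi; rewrite -Hb Rk_swap; last by lia.
rewrite (Rk_col _ _ b); lia.
Qed.

(** Each letter moves a value by at most one, so the image of [k] must cross the cuts [i], ..., [j]
    in turn, each by its own letter. Words act from right to left, so these letters appear in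
    decreasing order. *)
Lemma crossing_subword s i j (k : 'I_n) : k < i -> i <= j -> j <= word_perm n s k ->
  subseq (rev (iota i (j - i).+1)) s.
Proof.
have iota_last : forall j, i <= j -> rev (iota i (j - i).+1) = j :: rev (iota i (j - i)).
  by move=> j' ij; rewrite -addn1 iotaD rev_cat subnKC.
elim: s j => [|c s IH] j ki ij; first by rewrite perm1; lia.
have [le|lt] := leqP j (word_perm n s k).
  by move=> _; apply: subseq_trans (IH j ki ij le) (subseq_cons _ _).
rewrite [word_perm n _]/= permM => H.
have Hc : 0 < c < n.
  by apply: contraLR H => /st_out ->; rewrite perm1 -ltnNge.
have [E1 E2] : c = j /\ word_perm n s k = j.-1 :> nat.
  by move: H; rewrite val_st //; do ![case: eqP]; lia.
subst c; rewrite iota_last //= eqxx.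
case: (ltngtP i j) ij => // [ij _|-> _]; last by rewrite subnn sub0seq.
have := IH j.-1 ki; rewrite E2 leqnn (_ : (j.-1 - i).+1 = j - i); last by lia.
by apply; first lia.
Qed.

Lemma word_rev_iota i m (k : 'I_n) : k.+1 = i -> k + m < n ->
  word_perm n (rev (iota i m)) k = k + m :> nat.
Proof.
move=> ki; elim: m => [|m IH] lt; first by rewrite perm1 addn0.
rewrite -addn1 iotaD rev_cat /= permM val_st; last by lia.
by rewrite IH; [do ![case: eqP]; lia|lia].
Qed.

Lemma dec_run_Rk i j : 0 < i -> i <= j -> j < n ->
  0 < Rk (word_perm n (rev (iota i (j - i).+1))) i j.
Proof.
move=> i0 ij jn; have kn : i.-1 < n by lia.
apply/Rk_gt0P; exists (Ordinal kn); first by rewrite /=; lia.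
by rewrite word_rev_iota; rewrite /=; lia.
Qed.

Lemma is_run_rev r : is_run (rev r) = is_run r.
Proof.
have head_rev (s : seq nat) : s != [::] -> head 0 (rev s) = last 0 s.
  by case/lastP: s => // s c _; rewrite rev_rcons last_rcons.
have last_rev (s : seq nat) : s != [::] -> last 0 (rev s) = head 0 s.
  by case: s => // c s _; rewrite rev_cons last_rcons.
case: (eqVneq r [::]) => [->//|r0].
rewrite /is_run /inc_run /dec_run size_rev head_rev // last_rev //.
by rewrite (inj_eq (can_inj revK)) -(inj_eq (can_inj revK)) revK orbC.
Qed.

Lemma is_run_iota i m : is_run (iota i m.+1).
Proof. by rewrite /is_run /inc_run /= size_iota eqxx. Qed.

(** The entry is 1 for [s] and 0 for [w], and the run that crosses the cuts [i], ..., [j] already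
    makes it positive. *)
Lemma not_le_run_dec s w i j : uniq s -> i <= j -> Rk w i j < Rk (word_perm n s) i j ->
  exists r, [/\ is_run r, subseq r s & ~~ bruhat_le (word_perm n r) w].
Proof.
move=> us ij lt.
have : 0 < Rk (word_perm n s) i j by lia.
case/Rk_gt0P => k ki jk.
exists (rev (iota i (j - i).+1)); split; first by rewrite is_run_rev is_run_iota.
  exact: crossing_subword ki ij jk.
apply/negP => /bruhat_Rk_gt0 -/(_ i j); rewrite dec_run_Rk //; try lia.
  have := Rk_word_le s ij; rewrite count_uniq_mem //; lia.
by apply: leq_ltn_trans jk _.
Qed.

Lemma not_le_run s w : uniq s -> ~~ bruhat_le (word_perm n s) w ->
  exists r, [/\ is_run r, subseq r s & ~~ bruhat_le (word_perm n r) w].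
Proof.
move=> us H.
have [i [j [le_i le_j lt]]] : exists i j, [/\ i <= n, j <= n & Rk w i j < Rk (word_perm n s) i j].
  case: (pickP (fun ij : 'I_n.+1 * 'I_n.+1 => Rk w ij.1 ij.2 < Rk (word_perm n s) ij.1 ij.2)).
    by move=> [i j] /= lt; exists i, j; rewrite -ltnS ltn_ord -ltnS ltn_ord.
  move=> H1; case/negP: H; apply: tableau_criterion => i j le_i le_j.
  rewrite leqNgt; apply/negbT.
  by have := H1 (Ordinal (le_i : i < n.+1), Ordinal (le_j : j < n.+1)).
have [ij|/ltnW ji] := leqP i j; first exact: not_le_run_dec lt.
(* Below the diagonal the inverses are compared: [Rk_inv] shifts both entries by the same amount,
   and the run found in [rev s] is read backwards. *)
have us' : uniq (rev s) by rewrite rev_uniq.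
have lt' : Rk (w^-1)%g j i < Rk (word_perm n (rev s)) j i.
  by rewrite -(ltn_add2r i) word_perm_rev -!Rk_inv // ltn_add2r.
have [r [r1 r2 r3]] := not_le_run_dec us' ji lt'.
exists (rev r); rewrite is_run_rev -subseq_rev revK; split=> //.
by rewrite word_perm_rev -bruhat_leVE invgK.
Qed.

End BruhatOrder.

(** * Mod 2 homology of complexes given by nonfaces *)

Section Homology.
Variable T : finType.
Implicit Types (D : {set {set T}}) (S V F X Y Z : {set T}) (c e : {set T} -> bool).

(* Mod 2 chains are boolean functions on faces; the empty face is included, so
   this is the augmented chain complex, and a face with j elements has degree j. *)
Definition bd c S : bool := \big[addb/false]_(t | t \notin S) c (t |: S).

Definition chain_in D j c := forall S, c S -> S \in D /\ #|S| = j.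

(** For a complex [D] this is the vanishing of reduced homology in topological dimension [j - 1]. *)
Definition exact_at D j := forall c, chain_in D j c -> (forall S, bd c S = false) ->
  exists2 e, chain_in D j.+1 e & forall S, bd e S = c S.

Definition face_closed D := forall S X, S \in D -> X \subset S -> X \in D.

Lemma eq_bd c e : c =1 e -> bd c =1 bd e.
Proof. by move=> E S; apply: eq_bigr => t _; rewrite E. Qed.

Lemma bd_add c e S : bd (fun X => c X (+) e X) S = bd c S (+) bd e S.
Proof. exact: big_split. Qed.

Lemma bd0 S : bd (fun=> false) S = false.
Proof. exact: big1. Qed.

Lemma bd_neq0 c S : bd c S -> exists2 t, t \notin S & c (t |: S).
Proof.
move=> H; case: (pickP (fun t => (t \notin S) && c (t |: S))) => [t /andP []|H0]; first by exists t.
move: H; rewrite /bd big1 // => t tS.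
by have := H0 t; rewrite tS.
Qed.

(** The double sum runs over ordered pairs of distinct added vertices and its summand is symmetric,
    so the two orders cancel mod 2. *)
Lemma bd_bd c S : bd (bd c) S = false.
Proof.
pose h t s := [&& t \notin S, s \notin S, t != s & c (s |: (t |: S))].
have hC t s : h t s = h s t by rewrite /h setUCA eq_sym; case: (t \notin S); case: (s \notin S).
have -> : bd (bd c) S = \big[addb/false]_t \big[addb/false]_s h t s.
  rewrite /bd big_mkcond; apply: eq_bigr => t _; rewrite /h; case: (t \notin S).
    rewrite big_mkcond; apply: eq_bigr => s _.
    by rewrite in_setU1 negb_or eq_sym andbC /=; case: (s \notin S); case: (s == t).
  by rewrite big1.
pose lt (t s : T) := enum_rank t < enum_rank s.
have hE t s : h t s = (h t s && lt t s) (+) (h s t && lt s t).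
  rewrite (hC s t); case: (boolP (h t s)) => //= /and4P [_ _ ts _].
  rewrite /lt; case: ltngtP => // /val_inj/enum_rank_inj E.
  by rewrite E eqxx in ts.
transitivity (\big[addb/false]_t (\big[addb/false]_s (h t s && lt t s) (+)
    \big[addb/false]_s (h s t && lt s t))).
  by apply: eq_bigr => t _; rewrite -big_split; apply: eq_bigr => s _; apply: hE.
by rewrite big_split /= [X in _ (+) X]exchange_big addbb.
Qed.

(* The cone from [t] is a contracting homotopy. *)
Lemma exact_cone D j t : (forall S, (t |: S \in D) = (S \in D)) -> exact_at D j.
Proof.
move=> Dt c Dc bc; pose e S := (t \in S) && c (S :\ t).
exists e => S.
  case/andP => tS /Dc [H1 H2]; split; last by rewrite (cardsD1 t) tS H2.
  by rewrite -(setD1K tS) Dt.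
have [tS|tS] := boolP (t \in S); last first.
  rewrite /bd (bigD1 t) //= big1 ?addbF /e; first by rewrite setU11 setU1K.
  by move=> s /andP [_ st]; rewrite in_setU1 (negbTE tS) orbF eq_sym (negbTE st).
have := bc (S :\ t); rewrite /bd (bigD1 t) ?setD11 //= setD1K //.
move=> /negbT; rewrite negb_add => /eqP ->.
rewrite /bd; apply: eq_big => [s|s].
  by rewrite in_setD1 negb_and negbK; case: eqVneq => [->|_]; rewrite ?tS ?andbF ?andbT.
move=> sS; rewrite /e in_setU1 tS orbT /=; congr c; apply/setP => x; rewrite !inE.
have st : s != t by apply: contraNneq sS => ->.
by case: (eqVneq x s) => [->|_] //; rewrite st.
Qed.

(** Nonfaces form a list, so that subfamilies are counted by [size] even when several [G :\: F]
    coincide in a link. *)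
Definition avoiding V (Fs : seq {set T}) : {set {set T}} :=
  [set S : {set T} | (S \subset V) && all (fun F : {set T} => ~~ (F \subset S)) Fs].

Lemma avoidingP V Fs S :
  reflect (S \subset V /\ forall F, F \in Fs -> ~~ (F \subset S)) (S \in avoiding V Fs).
Proof. by rewrite inE; apply: (iffP andP) => -[-> /allP]. Qed.

Lemma face_closed_avoiding V Fs : face_closed (avoiding V Fs).
Proof.
move=> S X /avoidingP [SV H] XS; apply/avoidingP; split; first exact: subset_trans SV.
by move=> F /H; apply: contra => /subset_trans; apply.
Qed.

Lemma disjointsU1 t S F : [disjoint t |: S & F] = (t \notin F) && [disjoint S & F].
Proof. by rewrite !disjoints_subset subUset sub1set inE. Qed.

Lemma disjoint_setD S F : [disjoint S :\: F & F].
Proof. by rewrite disjoints_subset; apply/subsetP => x; rewrite !inE => /andP []. Qed.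

(* The shape of Taylor's resolution: adding a nonface [F] removes the open star
   of [F], whose homology is that of the link of [F], i.e. of the faces of
   [V :\: F] avoiding the sets [Fi :\: F]. *)
Lemma exact_avoiding Fs V j :
  all (fun F : {set T} => F \subset V) Fs ->
  (forall Gs, subseq Gs Fs -> size Gs + j = #|V| -> ~~ (V \subset \bigcup_(G <- Gs) G)) ->
  exact_at (avoiding V Fs) j.
Proof.
have [m] := ubnP (size Fs); elim: m Fs V j => // m IH [|F Fs] V j.
  (* Without nonfaces the complex is a full simplex, a cone from any vertex. If [V] is empty, only
     degree 0 could fail, and there the empty family covers [V]. *)
  move=> _ _ H; case: (set_0Vmem V) => [V0|[t tV]].
    move=> c Dc _; exists (fun=> false) => // S; rewrite bd0.
    apply/esym/negbTE/negP => /Dc [/avoidingP [SV _] Sj].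
    move: SV; rewrite V0 subset0 => /eqP S0; move: Sj; rewrite S0 cards0 => j0.
    by have := H [::] isT; rewrite -j0 V0 cards0 sub0set => /(_ erefl).
  apply: (@exact_cone _ _ t) => S; rewrite !inE !andbT.
  by rewrite subUset sub1set tV.
move=> /=; rewrite ltnS => sz /andP [FV FsV] H c Dc bc.
have DF S : S \in avoiding V Fs -> ~~ (F \subset S) -> S \in avoiding V (F :: Fs).
  by rewrite !inE /= => /andP [-> ->] ->.
have FD S : S \in avoiding V (F :: Fs) -> S \in avoiding V Fs /\ ~~ (F \subset S).
  by rewrite !inE /= => /and3P [-> -> ->].
have [||e De be] := IH Fs V j sz FsV _ c _ bc.
- by move=> Gs sGs; apply: H; apply: subseq_trans sGs (subseq_cons _ _).
- by move=> S /Dc [/FD [] ].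
have [lt|le] := ltnP j.+1 #|F|.
  exists e => // S eS; have [H1 H2] := De _ eS; split=> //; apply: DF => //.
  by apply: contraL lt => /subset_leq_card; rewrite H2 -leqNgt.
(* The part of [e] in the star of [F], seen in the link. It is a cycle there because [c], the
   boundary of [e], has no face containing [F]. *)
pose f S := [disjoint S & F] && e (S :|: F).
pose W := V :\: F; pose Gs := [seq G :\: F | G <- Fs].
have linkE S : [disjoint S & F] -> (S \in avoiding W Gs) = (S :|: F \in avoiding V Fs).
  move=> dis; rewrite !inE subsetD dis andbT subUset FV andbT all_map; congr (_ && _).
  by apply: eq_all => G /=; rewrite subDset setUC.
have cardF S : [disjoint S & F] -> #|S :|: F| = #|S| + #|F|.
  by move=> dis; rewrite cardsU disjoint_setI0 // cards0 subn0.
have Df : chain_in (avoiding W Gs) (j.+1 - #|F|) f.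
  move=> S /andP [dis /De [H1 H2]]; split; first by rewrite linkE.
  by rewrite -H2 cardF // addnK.
have bf S : bd f S = false.
  have [dis|ndis] := boolP [disjoint S & F]; last first.
    apply: big1 => t _; rewrite /f; apply/andP => -[dis _]; case/negP: ndis.
    exact: disjointWl (subsetUr _ _) dis.
  transitivity (bd e (S :|: F)).
    rewrite /bd (bigID (mem F)) /= big1 ?addFb.
      apply: eq_big => [t|t /andP [tS tF]]; first by rewrite in_setU negb_or.
      by rewrite /f -setUA disjointsU1 tF dis.
    by move=> t /andP [_ tF]; rewrite /f disjointsU1 tF.
  rewrite be; apply/negP => /Dc [/FD [_ /negP]]; case.
  exact: subsetUr.
have szGs : size Gs < m by rewrite size_map.
have [|Gs' sub1 sz1|g Dg bg] := IH Gs W (j.+1 - #|F|) szGs _ _ f Df bf.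
- by apply/allP => _ /mapP [G GFs ->]; apply: setSD; apply: (allP FsV).
(* A cover of [W] by sets [G :\: F] becomes a cover of [V] by the sets [G] together with [F]; the
   extra set accounts for the shift from [j] to [j.+1 - #|F|]. *)
- have [mk _ E] := subseqP sub1.
  have E2 : Gs' = [seq G :\: F | G <- mask mk Fs] by rewrite E map_mask.
  have := H (F :: mask mk Fs); rewrite /= eqxx mask_subseq => /(_ isT) H1.
  have WF : #|W| + #|F| = #|V|.
    by rewrite cardsD (setIidPr FV) subnK // subset_leq_card.
  have : ~~ (V \subset \bigcup_(G <- F :: mask mk Fs) G).
    apply: H1; move: sz1; rewrite E2 size_map; lia.
  apply: contra => sub; rewrite big_cons -subDset; apply: subset_trans sub _.
  rewrite E2 big_map; elim: (mask mk Fs) => [|G Hs IHs]; rewrite ?big_nil ?big_cons //.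
  by apply: setUSS => //; apply: subsetDl.
(* Joining [F] back to [g]: adding [bd h] to [e] cancels all faces containing [F] without changing
   the boundary. *)
pose h S := (F \subset S) && g (S :\: F).
have h_in S : h S -> S \in avoiding V Fs /\ #|S| = j.+2.
  case/andP => FS /Dg [H1 H2].
  have dis := disjoint_setD S F.
  have SE : (S :\: F) :|: F = S by rewrite setUC -{1}(setIidPr FS) setID.
  rewrite linkE // SE in H1; split=> //; rewrite -SE cardF // H2; lia.
have bh S : F \subset S -> bd h S = e S.
  move=> FS.
  have dis := disjoint_setD S F.
  transitivity (bd g (S :\: F)).
    rewrite /bd [RHS](bigID (mem F)) /= [X in _ = X (+) _]big1 ?addFb.
      apply: eq_big => [t|t tS].
        rewrite in_setD negb_and negbK; case: (boolP (t \in F)) => tF; last by rewrite andbT.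
        by rewrite andbF (subsetP FS).
      have tF : t \notin F by apply: contra tS; apply: (subsetP FS).
      rewrite /h (subset_trans FS (subsetUr _ _)) /=; congr g; apply/setP => x; rewrite !inE.
      by case: (eqVneq x t) => [->|_] //; rewrite tF.
    move=> t /andP [_ tF]; apply/negbTE/negP => /Dg [/avoidingP [H1 _] _].
    by move/subsetP: H1 => /(_ t (setU11 _ _)); rewrite in_setD tF.
  by rewrite bg /f dis /= setUC -{1}(setIidPr FS) setID.
exists (fun S => e S (+) bd h S) => [S eS|S]; last by rewrite bd_add be bd_bd addbF.
have [H1 H2] : S \in avoiding V Fs /\ #|S| = j.+1.
  case: (boolP (e S)) eS => [/De //|_ /bd_neq0 [t tS /h_in [H1 H2]]].
  split; first by apply: face_closed_avoiding H1 _; apply: subsetUr.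
  by move: H2; rewrite cardsU1 tS => -[].
split=> //; apply: DF => //; apply/negP => FS.
by move: eS; rewrite bh // addbb.
Qed.

End Homology.

(** * Almost perfect matchings and homology *)

(* Built from the bottom of the poset upwards, i.e. from the last block of the
   chain of coideals to the first; [None] when there is no unmatched element. *)
Inductive apm (T : finType) (le : rel T) (rk : T -> nat) : {set T} -> option T -> Prop :=
| ApmNil : apm le rk set0 None
| ApmPair (Q : {set T}) o (x y : T) of x \notin Q & y \notin Q & le x y & rk y = (rk x).+1
    & (forall a, a \in Q -> ~~ le x a /\ ~~ le y a) & apm le rk Q o :
    apm le rk (x |: (y |: Q)) o
| ApmSingle (Q : {set T}) (z : T) of z \notin Q & (forall a, a \in Q -> ~~ le z a) & apm le rk Q None :
    apm le rk (z |: Q) (Some z).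

Lemma apm_imset (T T' : finType) (le : rel T) rk (le' : rel T') rk' (f : T -> T') (Q : {set T}) o :
  {in Q &, forall x y, le' (f x) (f y) = le x y} ->
  {in Q, forall x, rk' (f x) = rk x} -> {in Q &, injective f} ->
  apm le rk Q o -> apm le' rk' (f @: Q) (omap f o).
Proof.
move=> Hle Hrk Hf H; elim: H Hle Hrk Hf => {Q o} [|Q o x y xQ yQ xy rxy H _ IH|Q z zQ H _ IH] Hle Hrk Hf.
- by rewrite imset0; apply: ApmNil.
- have inx : x \in x |: (y |: Q) by rewrite setU11.
  have iny : y \in x |: (y |: Q) by rewrite !inE eqxx orbT.
  have sub : {subset Q <= x |: (y |: Q)} by move=> a aQ; rewrite !inE aQ !orbT.
  rewrite !imsetU1; apply: ApmPair.
  + by apply/imsetP => -[a aQ /Hf E]; move: xQ; rewrite E ?aQ //; apply: sub.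
  + by apply/imsetP => -[a aQ /Hf E]; move: yQ; rewrite E ?aQ //; apply: sub.
  + by rewrite Hle.
  + by rewrite !Hrk.
  + by move=> _ /imsetP [a aQ ->]; have aD := sub a aQ; rewrite !Hle //; apply: H.
  + apply: IH => [a b aQ bQ|a aQ|a b aQ bQ].
    * by apply: Hle; apply: sub.
    * by apply: Hrk; apply: sub.
    * by apply: Hf; apply: sub.
- have inz : z \in z |: Q by rewrite setU11.
  have sub : {subset Q <= z |: Q} by move=> a aQ; rewrite !inE aQ !orbT.
  rewrite imsetU1; apply: ApmSingle.
  + by apply/imsetP => -[a aQ /Hf E]; move: zQ; rewrite E ?aQ //; apply: sub.
  + by move=> _ /imsetP [a aQ ->]; have aD := sub a aQ; rewrite !Hle //; apply: H.
  + apply: IH => [a b aQ bQ|a aQ|a b aQ bQ].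
    * by apply: Hle; apply: sub.
    * by apply: Hrk; apply: sub.
    * by apply: Hf; apply: sub.
Qed.

(** The blocks of [Q1] are stacked on the finished matching of [Q2]. The lower part must be perfect,
    since [ApmSingle] sits on a perfect matching. *)
Lemma apm_union (T : finType) (le : rel T) rk (Q1 Q2 : {set T}) o :
  [disjoint Q1 & Q2] -> (forall a b, a \in Q2 -> b \in Q1 -> ~~ le b a) ->
  apm le rk Q1 o -> apm le rk Q2 None -> apm le rk (Q1 :|: Q2) o.
Proof.
move=> dis H H1 H2.
elim: H1 dis H => {Q1 o} [|Q o x y xQ yQ xy rxy HQ _ IH|Q z zQ HQ _ IH] dis H.
- by rewrite set0U.
- move: dis; rewrite !disjointsU1 => /and3P [x2 y2 dis].
  rewrite -!setUA; apply: ApmPair => //; rewrite ?inE ?negb_or ?xQ ?yQ //.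
    move=> a; rewrite inE => /orP [/HQ //|a2]; split; apply: H => //.
      exact: setU11.
    by rewrite !inE eqxx orbT.
  by apply: IH => // a b a2 bQ; apply: H; rewrite // !inE bQ !orbT.
- move: dis; rewrite disjointsU1 => /andP [z2 dis].
  rewrite -!setUA; apply: ApmSingle => //; rewrite ?inE ?negb_or ?zQ //.
    move=> a; rewrite inE => /orP [/HQ //|a2]; apply: H => //.
    exact: setU11.
  by apply: IH => // a b a2 bQ; apply: H; rewrite // !inE bQ !orbT.
Qed.

Lemma apm_unmatched_in (T : finType) (le : rel T) rk (Q : {set T}) z :
  apm le rk Q (Some z) -> z \in Q.
Proof.
move E : (Some z) => o H; elim: H E => {Q o} [//|Q o x y _ _ _ _ _ _ IH /IH H|Q z' _ _ _ _ [->]].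
  by rewrite !inE H !orbT.
exact: setU11.
Qed.

Section FaceMatchings.
Variable T : finType.
Implicit Types (D Q : {set {set T}}) (S V F U X Y Z : {set T}) (c e : {set T} -> bool).

Definition subset_rel : rel {set T} := fun X Y => X \subset Y.
Definition card_rk S := #|S|.
Definition face_apm := apm subset_rel card_rk.

(** * Elementary collapses and exactness *)

Section PairRemoval.
Variables (Q : {set {set T}}) (X Y : {set T}).
Hypotheses (XQ : X \notin Q) (XY : X \subset Y) (cY : #|Y| = #|X|.+1).
Hypothesis topXY : forall S, S \in Q -> ~~ (X \subset S) /\ ~~ (Y \subset S).
Let D := X |: (Y |: Q).
Hypothesis Dclosed : face_closed D.

(** [X] is a free face: [Y] is the only face of [D] properly containing it. *)
Lemma bd_free_face c : (forall S, c S -> S \in D) -> bd c X = c Y.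
Proof.
move=> Dc.
have [t tY] : exists t, t \in Y :\: X.
  by apply/set0Pn; rewrite -card_gt0 cardsD (setIidPr XY) cY subSnn.
rewrite inE in tY; case/andP: tY => tX tY.
have YE : Y = t |: X.
  by apply/eqP; rewrite eq_sym eqEcard subUset sub1set tY XY cardsU1 tX cY leqnn.
rewrite /bd (bigD1 t) //= -YE big1 ?addbF // => s /andP [sX st].
apply/negbTE/negP => /Dc; rewrite !inE => /or3P [/eqP E|/eqP E|].
- by move: sX; rewrite -{1}E setU11.
- have : s \in Y by rewrite -E setU11.
  by rewrite YE in_setU1 (negbTE st) (negbTE sX).
- by move=> /topXY [/negP []]; apply: subsetUr.
Qed.

Lemma bd_pred1 S : bd (pred1 Y) S -> [/\ S \in D, S != Y & #|S| = #|X|].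
Proof.
move/bd_neq0 => [t tS /eqP E].
have cS : #|S| = #|X| by move: cY; rewrite -E cardsU1 tS => -[].
split=> //; last by apply: contra_eq_neq cS => ->; rewrite cY neq_ltn ltnSn orbT.
by apply: (Dclosed (S := Y)); rewrite -?E ?subsetUr // E !inE eqxx orbT.
Qed.

(** Pushing a chain off [X] through [Y], by adding the boundary of [Y] when [X] occurs. *)
Let push c S := c S (+) (c X && bd (pred1 Y) S).

Lemma bd_push c S : bd (push c) S = bd c S.
Proof.
rewrite bd_add; case: (c X); last by rewrite bd0 addbF.
by rewrite [X in _ (+) X](eq_bd (e := bd (pred1 Y))) // bd_bd addbF.
Qed.

Lemma push_in c j : chain_in D j c -> c Y = false -> chain_in Q j (push c).
Proof.
move=> Dc cYF S pS.
have bX : bd (pred1 Y) X.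
  by rewrite bd_free_face /= ?eqxx // => S' /eqP ->; rewrite !inE eqxx orbT.
have SX : S != X by apply: contraL pS => /eqP ->; rewrite /push bX andbT addbb.
have [SD SY Sj] : [/\ S \in D, S != Y & #|S| = j].
  move: pS; rewrite /push; case: (boolP (c S)) => [cS _|_ /= /andP [/Dc [_ <-]]].
    by have [? ?] := Dc _ cS; split=> //; apply: contraTneq cS => ->; rewrite cYF.
  exact: bd_pred1.
by split=> //; move: SD; rewrite !inE (negbTE SX) (negbTE SY).
Qed.

(** A cycle does not contain [Y], as its boundary at [X] would show it. Pushed off [X] it bounds in
    [Q], and adding [Y] to the bounding chain undoes the push. *)
Lemma exact_pair_add j : exact_at Q j -> exact_at D j.
Proof.
move=> ex c Dc bc.
have cYF : c Y = false by rewrite -bd_free_face ?bc // => S /Dc [].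
have [|e Qe be] := ex _ (push_in Dc cYF); first by move=> S; rewrite bd_push.
exists (fun S => e S (+) (c X && pred1 Y S)) => S.
  case: (boolP (e S)) => [/Qe [SQ ->] _|_ /= /andP [/Dc [_ <-] /eqP ->]].
    by rewrite !inE SQ !orbT.
  by rewrite !inE eqxx orbT cY.
rewrite bd_add be /push; case: (c X); last by rewrite bd0 !addbF.
by rewrite -addbA [X in _ (+) (_ (+) X)](eq_bd (e := pred1 Y)) // addbb addbF.
Qed.

(** A chain of [D] bounding [c] does not contain [Y], because [c X] is zero; pushing it off [X]
    keeps its boundary. *)
Lemma exact_pair_del j : exact_at D j -> exact_at Q j.
Proof.
move=> ex c Qc bc.
have [|e De be] := ex c _ bc; first by move=> S /Qc [H ->]; rewrite !inE H !orbT.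
have eYF : e Y = false.
  rewrite -bd_free_face ?be; last by move=> S /De [].
  by apply/negbTE; apply: contra XQ => /Qc [].
by exists (push e); [apply: push_in|move=> S; rewrite bd_push].
Qed.

End PairRemoval.

(** The boundary of [Z] is a cycle of [Q], so it bounds some [c] there. Then [Z + c] is a cycle, and
    it cannot be filled since no face properly contains [Z]. *)
Lemma not_exact_single Q Z : Z \notin Q -> (forall S, S \in Q -> ~~ (Z \subset S)) ->
  face_closed (Z |: Q) -> (forall j, exact_at Q j) -> ~ exact_at (Z |: Q) #|Z|.
Proof.
move=> ZQ top cl exQ ex.
have bZ S : bd (pred1 Z) S -> S \in Q /\ #|S|.+1 = #|Z|.
  move/bd_neq0 => [t tS /eqP E]; rewrite -E cardsU1 tS; split=> //.
  have : S \in Z |: Q by apply: cl (setU11 _ _) _; rewrite -E subsetUr.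
  by rewrite in_setU1 => /orP [/eqP SZ|//]; move: tS; rewrite SZ -{1}E setU11.
have [c Qc bc] : exists2 c, chain_in Q #|Z| c & forall S, bd c S = bd (pred1 Z) S.
  (* For empty [Z] the boundary would have degree -1; it is zero and the zero chain serves. *)
  case cZ : #|Z| => [|j].
    exists (fun=> false) => // S; rewrite bd0; apply/esym/negbTE/negP => /bZ [].
    by rewrite cZ.
  apply: exQ; last exact: bd_bd.
  by move=> S /bZ [SQ cS]; split=> //; move: cS; rewrite cZ => -[].
have [S|S|e De be] := ex (fun S => pred1 Z S (+) c S).
- case: (boolP (pred1 Z S)) => [/eqP -> _|_ /= /Qc [SQ ->]].
    by rewrite setU11.
  by rewrite in_setU1 SQ orbT.
- by rewrite bd_add bc addbb.
have : bd e Z by rewrite be /= eqxx /=; apply/negP => /Qc []; rewrite (negbTE ZQ).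
case/bd_neq0 => t tZ /De [].
rewrite in_setU1 => /orP [/eqP E|tQ _]; first by move: tZ; rewrite -{1}E setU11.
by have := top _ tQ; rewrite subsetUr.
Qed.

Lemma apm_homology D o : face_apm D o -> face_closed D ->
  if o is Some Z then ~ exact_at D #|Z| else forall j, exact_at D j.
Proof.
elim=> {D o} [_ j|Q o X Y XQ YQ XY cY top _ IH cl|Q Z ZQ top _ IH cl].
- move=> c Dc _; exists (fun=> false) => // S; rewrite bd0.
  by apply/esym/negbTE/negP => /Dc []; rewrite inE.
- have Qcl : face_closed Q.
    move=> S S' SQ S'S; have [t1 t2] := top _ SQ.
    have : S' \in X |: (Y |: Q) by apply: cl S'S; rewrite !inE SQ !orbT.
    by rewrite !inE => /or3P [/eqP E|/eqP E|//];
       [case/negP: t1|case/negP: t2]; rewrite /subset_rel -E.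
  case: o IH => [Z|] /(_ Qcl) IH.
    by move=> ex; apply: IH; apply: (exact_pair_del XQ XY cY top cl).
  by move=> j; apply: (exact_pair_add XY cY top cl).
- have Qcl : face_closed Q.
    move=> S S' SQ S'S; have t1 := top _ SQ.
    have : S' \in Z |: Q by apply: cl S'S; rewrite !inE SQ !orbT.
    by rewrite !inE => /orP [/eqP E|//]; case/negP: t1; rewrite /subset_rel -E.
  exact: not_exact_single (IH Qcl).
Qed.

Lemma apm_avoiding_cover V Fs Z :
  all (fun F : {set T} => F \subset V) Fs -> face_apm (avoiding V Fs) (Some Z) ->
  exists Gs, [/\ subseq Gs Fs, size Gs + #|Z| = #|V| & V \subset \bigcup_(G <- Gs) G].
Proof.
move=> FsV H; have := apm_homology H (@face_closed_avoiding _ _ _).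
(* A witness is extracted from a negation by a decidable search through the finitely many masks of
   [Fs]. *)
have [|no] := boolP (has (fun m => (size (mask m Fs) + #|Z| == #|V|) &&
    (V \subset \bigcup_(G <- mask m Fs) G)) (codom (fun m : (size Fs).-tuple bool => tval m))).
  move=> /hasP [m _ /andP [/eqP H1 H2]] _.
  by exists (mask m Fs); rewrite mask_subseq.
case; apply: exact_avoiding => // Gs /subseqP [m sm ->] H1.
apply: contra no => H2; apply/hasP; exists m; last by rewrite H1 eqxx.
by apply/codomP; exists (Tuple (introT eqP sm)).
Qed.

(** A face [S] of largest size contains [t]. A member containing [S :\ t] becomes [S] once [t] is
    added, so [S :\ t] and [S] may be taken off the top, and the rest is still closed under
    toggling. *)
Lemma apm_toggle t Q :
  (forall S, S \in Q -> t |: S \in Q /\ S :\ t \in Q) -> face_apm Q None.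
Proof.
have [m] := ubnP #|Q|; elim: m Q => // m IH Q lt_m H.
case: (set_0Vmem Q) => [->|[S0 S0Q]]; first exact: ApmNil.
have [S SQ maxS] : exists2 S, S \in Q & forall S', S' \in Q -> #|S'| <= #|S|.
  by case: (arg_maxnP (fun S : {set T} => #|S|) S0Q) => S SQ HS; exists S.
have eqS S' : S' \in Q -> S \subset S' -> S' = S.
  by move=> S'Q SS'; apply/esym/eqP; rewrite eqEcard SS' maxS.
have tS : t \in S.
  by have [tSQ _] := H _ SQ; rewrite -(eqS _ tSQ (subsetUr _ _)) setU11.
have [_ St] := H _ SQ.
pose Q' := Q :\ S :\ (S :\ t).
have nSS : S :\ t != S by apply: contraTneq tS => <-; rewrite setD11.
have setD1id S' : t \notin S' -> S' :\ t = S'.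
  by move=> tS'; apply/setDidPl; rewrite disjoint_sym disjoints1.
have QE : Q = (S :\ t) |: (S |: Q') by rewrite setUCA !setD1K // in_setD1 nSS.
have top S' : S' \in Q' -> S :\ t \subset S' -> False.
  rewrite !in_setD1 => /and3P [n1 n2 S'Q] sub.
  have [tS' _] := H _ S'Q.
  have E : t |: S' = S.
    by apply: eqS => //; rewrite -(setD1K tS); apply: setUS.
  have [tS'2|tS'2] := boolP (t \in S').
    by case/eqP: n2; rewrite -E; apply/esym/setUidPr; rewrite sub1set.
  by case/eqP: n1; rewrite -E setU1K.
rewrite QE; apply: ApmPair.
- by rewrite in_setD1 eqxx.
- by rewrite !in_setD1 eqxx /= andbF.
- exact: subsetDl.
- by rewrite /card_rk (cardsD1 t S) tS.
- move=> S' S'Q'; split; apply/negP => sub; apply: (top _ S'Q') => //.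
  exact: subset_trans (subsetDl _ _) sub.
apply: IH.
  have lt : #|Q'| <= #|Q :\ S| by apply: subset_leq_card; apply: subsetDl.
  by apply: leq_ltn_trans lt _; rewrite (cardsD1 S Q) SQ in lt_m.
move=> S' S'Q'; have := S'Q'; rewrite !in_setD1 => /and3P [n1 n2 S'Q].
have [H1 H2] := H _ S'Q.
have ne : S' :\ t <> S :\ t.
  move=> E; case: (boolP (t \in S')) => tS'.
    by case/eqP: n2; rewrite -(setD1K tS') E setD1K.
  by case/eqP: n1; rewrite -E setD1id.
rewrite H1 H2 !andbT; split; apply/andP; split; apply/eqP => E.
- by have := setU11 t S'; rewrite E setD11.
- apply: ne; rewrite -E; apply/setP => x; rewrite !inE; by case: eqP.
- exact: ne.
- by have := tS; rewrite -E setD11.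
Qed.

End FaceMatchings.

(** * Matchings of joins of simplex boundaries, and chains of coideals *)

Section SphereMatching.
Variable T : finType.
Implicit Types (S V F U Z : {set T}) (Fs : seq {set T}).

Lemma in_bigcup_seq (x : T) Fs :
  (x \in \bigcup_(F <- Fs) F) = has (fun F : {set T} => x \in F) Fs.
Proof. by elim: Fs => [|F Fs IH]; rewrite ?big_nil ?big_cons ?inE //= IH. Qed.

(** [U] collects the facets [F :\ t] already fixed; only the remaining vertices vary. *)
Definition avoiding_above U Fs : {set {set T}} :=
  [set S : {set T} | [&& U \subset S, S \subset U :|: \bigcup_(F <- Fs) F
     & all (fun F : {set T} => ~~ (F \subset S)) Fs]].

(* In the boundary of the simplex [F] toggle a vertex [t]: only the facet
   [F :\ t] stays unmatched, and the matching is continued above it. *)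
Lemma apm_disjoint_above U Fs :
  pairwise (fun F G : {set T} => [disjoint F & G]) Fs ->
  all (fun F : {set T} => [disjoint U & F]) Fs -> all (fun F => F != set0) Fs ->
  exists2 Z, face_apm (avoiding_above U Fs) (Some Z)
    & #|Z| + size Fs = #|U| + #|\bigcup_(F <- Fs) F|.
Proof.
elim: Fs U => [|F Fs IH] U.
  move=> _ _ _; exists U; last by rewrite big_nil cards0.
  have -> : avoiding_above U [::] = U |: set0.
    apply/setP => S; rewrite !inE big_nil setU0 orbF andbT eqEsubset andbC.
    by [].
  by apply: ApmSingle; [rewrite inE|move=> a; rewrite inE|apply: ApmNil].
rewrite pairwise_cons => /andP [FFs pFs] /= /andP [UF UFs] /andP [F0 Fs0].
have [t tF] := set0Pn _ F0.
have tU : t \notin U by rewrite (disjointFl UF tF).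
have tFs : t \notin \bigcup_(G <- Fs) G.
  rewrite in_bigcup_seq -all_predC; apply/allP => G /(allP FFs) dis /=.
  by rewrite (disjointFr dis tF).
pose W := U :|: F :\ t.
have tW : t \notin W by rewrite !inE (negbTE tU) eqxx.
have [|Z HZ cZ] := IH W pFs _ Fs0.
  apply/allP => G GFs; rewrite disjoints_subset subUset -!disjoints_subset.
  rewrite (allP UFs) //=; apply: disjointWl (allP FFs _ GFs); exact: subD1set.
exists Z; last first.
  have dF : [disjoint F & \bigcup_(G <- Fs) G].
    rewrite disjoint_sym disjoints_subset; apply/subsetP => x.
    rewrite in_bigcup_seq => /hasP [G /(allP FFs) dis xG].
    by rewrite inE (disjointFl dis xG).
  have cW : #|W| = #|U| + #|F :\ t|.
    rewrite cardsU disjoint_setI0 ?cards0 ?subn0 //.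
    by apply: disjointWr UF; apply: subD1set.
  rewrite big_cons cardsU disjoint_setI0 // cards0 subn0.
  by have := cardsD1 t F; rewrite tF; lia.
have tt G S : G \in Fs -> (G \subset t |: S) = (G \subset S).
  move=> GFs; apply/idP/idP => [sub|/subset_trans]; last by apply; apply: subsetUr.
  apply/subsetP => x xG; have := subsetP sub x xG; rewrite in_setU1.
  case/orP => // /eqP xt; case/negP: tFs; rewrite in_bigcup_seq; apply/hasP.
  by exists G; rewrite -?xt.
(* Toggling [t] neither leaves [Q2] nor completes [F], so [Q2] is perfectly matched. It lies below
   the faces containing [F :\ t], and these omit [t]. *)
pose Q2 := [set S in avoiding_above U (F :: Fs) | ~~ (F :\ t \subset S)].
have inW S : (S \in avoiding_above W Fs) =
    (S \in avoiding_above U (F :: Fs)) && (F :\ t \subset S).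
  rewrite !inE /= subUset big_cons.
  case: (U \subset S) => //=; rewrite [RHS]andbC; case: (boolP (F :\ t \subset S)) => //= FS.
  have [tS|tS] := boolP (t \in S).
    have -> : (S \subset W :|: \bigcup_(G <- Fs) G) = false.
      apply/negbTE/negP => /subsetP /(_ t tS).
      by rewrite in_setU (negbTE tW) (negbTE tFs).
    have -> : F \subset S by rewrite -(setD1K tF) subUset sub1set tS.
    by rewrite andbF.
  have -> : F \subset S = false by apply/negbTE; apply: contra tS => /subsetP; apply.
  congr (_ && _); apply/idP/idP => /subsetP sub; apply/subsetP => x xS;
    have := sub x xS; rewrite !in_setU !in_setD1; case: eqVneq xS => [->|_ _] //=.
  - by rewrite (negbTE tS).
  - by rewrite orbA.
  - by rewrite (negbTE tS).
  - by rewrite orbA.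
have -> : avoiding_above U (F :: Fs) = avoiding_above W Fs :|: Q2.
  apply/setP => S; rewrite in_setU inW [S \in Q2]inE.
  by case: (S \in _) => //=; rewrite orbN.
apply: apm_union => //.
- rewrite disjoint_sym disjoints_subset; apply/subsetP => S; rewrite [S \in Q2]inE.
  by rewrite in_setC inW => /andP [_ H]; rewrite negb_and H orbT.
- move=> S' S; rewrite [S' \in Q2]inE inW => /andP [_ H] /andP [_ FS].
  by apply: contra H => sub; apply: subset_trans sub.
apply: (apm_toggle (t := t)) => S; rewrite !inE /= => /andP [/and4P [US SU FS aFs] FtS].
rewrite big_cons in SU *; split.
  rewrite (subset_trans US (subsetUr _ _)) subUset SU sub1set !inE tF orbT /=.
  rewrite -subDset FtS (eq_in_all (a2 := fun G : {set T} => ~~ (G \subset S))); last first.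
    by move=> G GFs; rewrite /= tt.
  rewrite aFs /=; apply: contra FtS => /subsetP sub; apply/subsetP => x xF.
  by have := sub x xF; move: xF; rewrite !inE => /andP [/negbTE -> _].
rewrite subsetD1 US tU (subset_trans (subD1set _ _) SU) /=; apply/andP; split.
  apply/andP; split.
    by apply: contra FS => sub; apply: subset_trans sub (subD1set _ _).
  apply/allP => G /(allP aFs); apply: contra => sub.
  exact: subset_trans sub (subD1set _ _).
by apply: contra FtS => sub; apply: subset_trans sub (subD1set _ _).
Qed.

Lemma apm_disjoint Fs :
  pairwise (fun F G : {set T} => [disjoint F & G]) Fs -> all (fun F => F != set0) Fs ->
  exists2 Z, face_apm (avoiding (\bigcup_(F <- Fs) F) Fs) (Some Z)
    & #|Z| + size Fs = #|\bigcup_(F <- Fs) F|.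
Proof.
move=> pFs Fs0; have [|Z] := @apm_disjoint_above set0 Fs pFs _ Fs0.
  by apply/allP => F _; rewrite disjoints_subset sub0set.
rewrite cards0 add0n => HZ cZ; exists Z => //.
have <- // : avoiding_above set0 Fs = avoiding (\bigcup_(F <- Fs) F) Fs.
by apply/setP => S; rewrite !inE sub0set set0U.
Qed.

End SphereMatching.

(** * Chains of coideals as inductive matchings *)

Section BruhatMatchings.
Variable n : nat.
Implicit Types (Q A b : {set {perm 'I_n}}) (bs : seq {set {perm 'I_n}}) (x y z : {perm 'I_n}).

Definition bruhat_apm := apm (@bruhat_le n) (@len n).

Lemma prefix_union0 bs : prefix_union bs 0 = set0.
Proof. by rewrite /prefix_union take0 big_nil. Qed.

Lemma prefix_unionS bs k : k < size bs ->
  prefix_union bs k.+1 = prefix_union bs k :|: nth set0 bs k.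
Proof. by move=> lt; rewrite /prefix_union (take_nth set0) // -cats1 big_cat big_seq1. Qed.

Lemma prefix_union_cons b bs k : prefix_union (b :: bs) k.+1 = b :|: prefix_union bs k.
Proof. by rewrite /prefix_union /= big_cons. Qed.

(** The complements [D k] of the coideals are rebuilt from the last one back to [Q]; nothing in
    [D k.+1] is above block [k], since the coideal containing that block is upward closed. *)
Lemma apm_of_chain Q bs z : almost_perfect_matching Q bs z -> bruhat_apm Q (Some z).
Proof.
case=> uQ [co [dis [i [ib [bi pairs]]]]].
pose D k := Q :\: prefix_union bs k.
have DS k : k < size bs -> [/\ D k = nth set0 bs k :|: D k.+1,
    [disjoint nth set0 bs k & D k.+1] &
    forall x y, x \in nth set0 bs k -> y \in D k.+1 -> ~~ bruhat_le x y].
  move=> kb; have /andP [sub /forall_inP up] := co k kb.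
  have db := dis k kb; rewrite prefix_unionS // in sub up.
  have Pk : prefix_union bs k \subset Q by apply: subset_trans sub; apply: subsetUl.
  have bQ : nth set0 bs k \subset Q by apply: subset_trans sub; apply: subsetUr.
  split.
  - apply/setP => x; rewrite /D prefix_unionS // !inE negb_or.
    case: (boolP (x \in nth set0 bs k)) => [xb|_]; rewrite ?andbT //=.
    by rewrite (disjointFr db xb) (subsetP bQ).
  - rewrite disjoint_sym disjoints_subset; apply/subsetP => x.
    by rewrite /D prefix_unionS // !inE negb_or => /andP [/andP [_ ->]].
  - move=> x a bb; rewrite /D prefix_unionS // in_setD => /andP [na aQ]; apply/negP => le.
    have bU : x \in prefix_union bs k :|: nth set0 bs k by rewrite in_setU bb orbT.
    have := forall_inP (up x bU) a aQ; rewrite le /= => H.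
    by rewrite H in na.
(* [D k] still contains the singleton block [i] exactly when [k <= i]. *)
have main m k : k + m = size bs -> bruhat_apm (D k) (if k <= i then Some z else None).
  elim: m k => [|m IH] k.
    rewrite addn0 => kE; rewrite leqNgt kE ib /= /D uQ setDv; exact: ApmNil.
  move=> kE; have kb : k < size bs by rewrite -kE -addSnnS leq_addr.
  have := IH k.+1; rewrite addSnnS => /(_ kE) {}IH.
  have [-> db top] := DS k kb.
  case: (eqVneq k i) => [ki|ki].
    rewrite ki leqnn ltnn in IH *; rewrite ki bi in db top.
    rewrite bi; apply: ApmSingle => //.
      by move: db; rewrite disjoints1.
    by move=> a aD; apply: top; rewrite ?set11.
  have [x [y [bE [/andP [xy _] ly]]]] := pairs k kb ki.
  rewrite bE -setUA in db top *; rewrite ltn_neqAle ki /= in IH.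
  move: db; rewrite disjointsU1 disjoints1 => /andP [xD yD].
  by apply: ApmPair => // a aD; split; apply: top; rewrite // !inE eqxx ?orbT.
have := main (size bs) 0 (add0n _); rewrite leq0n /D prefix_union0 setD0.
by [].
Qed.

(** The block added last lies on top, so it becomes the head of the list and joins every nonempty
    prefix. *)
Lemma chain_of_apm Q o : bruhat_apm Q o -> exists bs,
  [/\ prefix_union bs (size bs) = Q,
      forall k, k <= size bs -> coideal Q (prefix_union bs k),
      forall k, k < size bs -> [disjoint nth set0 bs k & prefix_union bs k] &
      if o is Some z then exists i, i < size bs /\ nth set0 bs i = [set z] /\
           forall j, j < size bs -> j != i -> matched_pair (nth set0 bs j)
      else forall j, j < size bs -> matched_pair (nth set0 bs j)].
Proof.
have coi0 Q' : coideal Q' set0.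
  by rewrite /coideal sub0set; apply/forall_inP => x; rewrite inE.
have consE b Q' bs : [disjoint b & Q'] ->
    (forall x a, x \in b -> a \in Q' -> ~~ bruhat_le x a) ->
    prefix_union bs (size bs) = Q' ->
    (forall k, k <= size bs -> coideal Q' (prefix_union bs k)) ->
    (forall k, k < size bs -> [disjoint nth set0 bs k & prefix_union bs k]) ->
    [/\ prefix_union (b :: bs) (size (b :: bs)) = b :|: Q',
      forall k, k <= size (b :: bs) -> coideal (b :|: Q') (prefix_union (b :: bs) k) &
      forall k, k < size (b :: bs) ->
        [disjoint nth set0 (b :: bs) k & prefix_union (b :: bs) k]].
  move=> db top uQ co dis; split; first by rewrite prefix_union_cons uQ.
    case=> [|k] kb; first by rewrite prefix_union0.
    have /andP [sub /forall_inP up] := co k kb.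
    rewrite prefix_union_cons /coideal setUS //=; apply/forall_inP => x xP.
    apply/forall_inP => y; rewrite !in_setU => /orP [->|yQ]; first by rewrite implybT.
    apply/implyP => le; move: xP; rewrite in_setU => /orP [xb|xP].
      by have := top x y xb yQ; rewrite le.
    by have := forall_inP (up x xP) y yQ; rewrite le /= => ->; rewrite orbT.
  case=> [|k] kb; first by rewrite prefix_union0 disjoint_sym disjoints_subset sub0set.
  rewrite prefix_union_cons /= disjoint_sym disjoints_subset subUset -!disjoints_subset.
  rewrite [X in _ && X]disjoint_sym dis // andbT.
  apply: disjointWr db; rewrite -uQ.
  have /andP [sub _] := co k.+1 kb; rewrite prefix_unionS // in sub.
  by rewrite uQ; apply: subset_trans sub; apply: subsetUr.
elim=> {Q o} [|Q o x y xQ yQ xy ly top _ [bs [uQ co dis Ho]]|Q z zQ top _ [bs [uQ co dis Ho]]].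
- exists [::]; split=> //; first exact: prefix_union0.
  by case=> // _; rewrite prefix_union0.
- have db : [disjoint [set x; y] & Q] by rewrite disjointsU1 disjoints1 xQ.
  have [|H1 H2 H3] := consE [set x; y] Q bs db _ uQ co dis.
    by move=> c a; rewrite !inE => /orP [] /eqP -> /top [].
  rewrite -setUA in H1 H2; exists ([set x; y] :: bs); split=> //.
  have mp : matched_pair [set x; y].
    exists x, y; split=> //; split=> //; rewrite /bruhat_lt xy.
    by apply: contra_eq_neq ly => ->; rewrite neq_ltn ltnSn.
  case: o Ho => [z [i [ib [bi Hp]]]|Hp]; last by case.
  exists i.+1; do 2 split => //; case=> [|j] //= jb ji; exact: Hp.
- have db : [disjoint [set z] & Q] by rewrite disjoints1.
  have [|H1 H2 H3] := consE [set z] Q bs db _ uQ co dis.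
    by move=> c a; rewrite !inE => /eqP -> /top.
  exists ([set z] :: bs); split=> //; exists 0; do 2 split => //.
  by case=> [|j] //= jb _; apply: Ho.
Qed.

Lemma has_apmP Q z : has_apm_with_unmatched Q z <-> bruhat_apm Q (Some z).
Proof.
split=> [[bs]|/chain_of_apm [bs [uQ co dis Hz]]]; first exact: apm_of_chain.
by exists bs; split=> //; split; [move=> k; apply: co|split].
Qed.

End BruhatMatchings.

(** * The faces of the intersection with a boolean ideal *)

Section Words.
Variable n : nat.
Implicit Types (s t r : seq nat) (a b k : 'I_n) (S F V : {set 'I_n}) (p w : {perm 'I_n}).

Definition tight t := size t = len (word_perm n t).

Lemma tight_cons c t : 0 < c < n -> tight t ->
  (forall a b, a = c.-1 :> nat -> b = c :> nat ->
    ((word_perm n t)^-1)%g a < ((word_perm n t)^-1)%g b) -> tight (c :: t).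
Proof.
move=> Hc Ht H; have [a [b [Ha Hb _]]] := st_tperm Hc.
case/andP: Hc => c0 _.
by rewrite /tight /= lenE (ninv_st_asc Ha Hb c0 (H a b Ha Hb)) -lenE -Ht.
Qed.

Lemma tight_consV c t : 0 < c < n -> tight (c :: t) -> tight t /\
  (forall a b, a = c.-1 :> nat -> b = c :> nat ->
    ((word_perm n t)^-1)%g a < ((word_perm n t)^-1)%g b).
Proof.
rewrite /tight /= => Hc Ht.
have E : size t = len (word_perm n t).
  by have := ninv_st_le (word_perm n t) c; have := ninv_word_le n t; rewrite -!lenE; lia.
split=> // a b Ha Hb; rewrite ltnNge leq_eqVlt; apply/negP => /orP [/eqP/val_inj/perm_inj H|H].
  by move: Ha; rewrite -H Hb; lia.
have [a' [b' [Ha' Hb' stE]]] := st_tperm Hc.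
have Ea : a' = a by apply: val_inj; rewrite /= Ha Ha'.
have Eb : b' = b by apply: val_inj; rewrite /= Hb Hb'.
subst a' b'; have ab : b = a.+1 :> nat by lia.
have := ninvM_adj_desc ab H; rewrite -stE -!lenE -E -Ht; lia.
Qed.

(** As [c] does not occur in the tail, the tail preserves the cut at [c], which separates the two
    values that [c] exchanges. *)
Lemma tight_uniq t : valid_word n t -> uniq t -> tight t.
Proof.
elim: t => [|c t IH] /=; first by rewrite /tight /= lenE ninv1.
move=> /andP [Hc vt] /andP [ct ut]; apply: tight_cons => //; first exact: IH.
move=> a b Ha Hb; apply: (@leq_trans c); first by rewrite word_permV_ltn // Ha; lia.
by rewrite leqNgt word_permV_ltn // Hb ltnn.
Qed.

(* Letters moved by [t1] are separated by no cut outside [t1], whereas [t2]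
   preserves every cut in [t1]; so [t2] keeps the order of the two values that
   the next letter exchanges. *)
Lemma tight_cat t1 t2 : valid_word n t1 -> tight t1 -> tight t2 ->
  (forall c, c \in t1 -> c \notin t2) -> tight (t1 ++ t2).
Proof.
elim: t1 => [|c t1 IH] //= /andP [Hc vt1] Ht1 Ht2 dis.
have [Ht1' asc] := tight_consV Hc Ht1.
apply: tight_cons => //.
  by apply: IH => // d dt; apply: dis; rewrite inE dt orbT.
move=> a b Ha Hb; have := asc a b Ha Hb.
rewrite word_perm_cat invMg !permM.
move E1 : (((word_perm n t1)^-1)%g a) => u; move E2 : (((word_perm n t1)^-1)%g b) => v uv.
have vt : (v : nat) \in c :: t1.
  apply: contraLR uv => nv; have := nv; rewrite inE negb_or => /andP [vc vt1'].
  have := word_permV_ltn a vt1'; have := word_permV_ltn b vt1'; rewrite E1 E2 => H1 H2.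
  move: H1; rewrite H2 ltnn Ha Hb; lia.
have v2 := dis _ vt; apply: (@leq_trans v); first by rewrite word_permV_ltn.
by rewrite leqNgt (word_permV_ltn v v2) ltnn.
Qed.

Lemma tight_rev t : tight t -> tight (rev t).
Proof. by rewrite /tight word_perm_rev size_rev lenV. Qed.

Lemma subseq_valid s t : subseq s t -> valid_word n t -> valid_word n s.
Proof. by move=> /mem_subseq sub /allP H; apply/allP => c /sub /H. Qed.

Lemma subword_uniq_le s t : valid_word n t -> uniq t -> subseq s t ->
  bruhat_le (word_perm n s) (word_perm n t).
Proof. by move=> vt ut; apply: subword_le; apply: tight_uniq. Qed.

Definition letters t : {set 'I_n} := [set c : 'I_n | val c \in t].
(** The diagonal of the rank matrix recovers the letters of a repetition-free word from its
    permutation, and so inverts the passage from letters to subwords. *)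
Definition support p : {set 'I_n} := [set c : 'I_n | 0 < Rk p c c].
Definition restrict s S := [seq c <- s | c \in [seq val d | d in S]].

Lemma mem_image_val S (c : 'I_n) : (val c \in [seq val d | d in S]) = (c \in S).
Proof. by rewrite mem_image //; apply: val_inj. Qed.

Lemma restrict_subseq s S : subseq (restrict s S) s.
Proof. exact: filter_subseq. Qed.

Lemma letters_restrict s S : S \subset letters s -> letters (restrict s S) = S.
Proof.
move=> sub; apply/setP => c; rewrite inE mem_filter mem_image_val.
by case: (boolP (c \in S)) => // /(subsetP sub); rewrite inE.
Qed.

Lemma restrict_letters s t : valid_word n s -> uniq s -> subseq t s -> restrict s (letters t) = t.
Proof.
move=> vs us /(subseq_uniqP us) ->; apply: eq_in_filter => c cs.
have /andP [_ cn] := allP vs c cs.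
by rewrite -[c]/(val (Ordinal cn)) mem_image_val inE /= mem_filter cs andbT.
Qed.

Lemma restrict_sub s S S' : S \subset S' -> subseq (restrict s S) (restrict s S').
Proof.
move=> sub; rewrite /restrict subseq_filter filter_subseq andbT.
apply/allP => c; rewrite mem_filter => /andP [/imageP [d dS ->] _].
by rewrite mem_image_val (subsetP sub).
Qed.

Lemma letters_sub s t : subseq s t -> letters s \subset letters t.
Proof. by move=> /mem_subseq sub; apply/subsetP => c; rewrite !inE => /sub. Qed.

Lemma card_letters s : valid_word n s -> uniq s -> #|letters s| = size s.
Proof.
move=> vs us; rewrite cardE -(size_map val); apply/eqP; rewrite -uniq_size_uniq //.
  by rewrite map_inj_uniq ?enum_uniq //; apply: val_inj.
move=> c; apply/idP/mapP => [cs|[d]]; last by rewrite mem_enum inE => ? ->.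
have /andP [_ cn] := allP vs c cs.
by exists (Ordinal cn); rewrite // mem_enum inE.
Qed.

Lemma support_word t : valid_word n t -> uniq t -> support (word_perm n t) = letters t.
Proof.
move=> vt ut; apply/setP => c; rewrite !inE; apply/idP/idP.
  move=> /Rk_gt0P [k kc ck]; have := crossing_subword kc (leqnn c) ck.
  by rewrite subnn /= sub1seq.
move=> ct; have /andP [c0 cn] := allP vt _ ct.
have : bruhat_le (word_perm n [:: val c]) (word_perm n t).
  by apply: subword_uniq_le; rewrite ?sub1seq.
move/bruhat_Rk_gt0; apply.
by have := dec_run_Rk c0 (leqnn c) cn; rewrite subnn.
Qed.

Lemma support_mono x y : bruhat_le x y -> support x \subset support y.
Proof. by move=> le; apply/subsetP => c; rewrite !inE; apply: bruhat_Rk_gt0. Qed.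

(** * Faces as sets of letters of a fixed boolean word *)

Section Boolean.
Variable s : seq nat.
Hypotheses (vs : valid_word n s) (us : uniq s).
Let v := word_perm n s.
Let phi S := word_perm n (restrict s S).

Lemma support_phi S : S \subset letters s -> support (phi S) = S.
Proof.
move=> sub; rewrite support_word ?letters_restrict //.
  exact: subseq_valid (restrict_subseq _ _) vs.
by rewrite filter_uniq.
Qed.

Lemma phi_le S S' : S \subset letters s -> S' \subset letters s ->
  bruhat_le (phi S) (phi S') = (S \subset S').
Proof.
move=> sub sub'; apply/idP/idP => [/support_mono|SS']; first by rewrite !support_phi.
apply: subword_uniq_le; last exact: restrict_sub.
  exact: subseq_valid (restrict_subseq _ _) vs.
by rewrite filter_uniq.
Qed.

Lemma len_phi S : S \subset letters s -> len (phi S) = #|S|.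
Proof.
move=> sub; have vr := subseq_valid (restrict_subseq s S) vs.
have ur : uniq (restrict s S) by rewrite filter_uniq.
by rewrite -(tight_uniq vr ur) -card_letters // letters_restrict.
Qed.

Lemma phi_support x : bruhat_le x v -> support x \subset letters s /\ phi (support x) = x.
Proof.
move=> /le_subword [t ts <-].
have vt := subseq_valid ts vs; have ut := subseq_uniq ts us.
by rewrite support_word // letters_sub // /phi restrict_letters.
Qed.

Definition ideal_faces w : {set {set 'I_n}} :=
  [set S : {set 'I_n} | (S \subset letters s) && bruhat_le (phi S) w].

Lemma phi_ideal w : phi @: ideal_faces w = B v :&: B w.
Proof.
apply/setP => x; apply/imsetP/idP => [[S]|].
  rewrite !inE => /andP [sub le] ->; rewrite le andbT.
  by apply: subword_uniq_le => //; apply: restrict_subseq.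
rewrite !inE => /andP [/phi_support [sub E] le].
by exists (support x); rewrite // inE sub E.
Qed.

Lemma support_ideal w : support @: (B v :&: B w) = ideal_faces w.
Proof.
rewrite -phi_ideal -imset_comp -[RHS]imset_id; apply: eq_in_imset => S.
by rewrite inE => /andP [sub _] /=; apply: support_phi.
Qed.

Lemma face_apm_of_bruhat w z : bruhat_apm (B v :&: B w) (Some z) ->
  face_apm (ideal_faces w) (Some (support z)).
Proof.
rewrite -support_ideal => H; apply: (apm_imset (o := Some z) _ _ _ H).
- move=> x y; rewrite !inE => /andP [/phi_support [sx Ex] _] /andP [/phi_support [sy Ey] _].
  by rewrite -{2}Ex -{2}Ey phi_le.
- move=> x; rewrite !inE => /andP [/phi_support [sx Ex] _].
  by rewrite -{2}Ex len_phi.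
- move=> x y; rewrite !inE => /andP [/phi_support [sx Ex] _] /andP [/phi_support [sy Ey] _] E.
  by rewrite -Ex E.
Qed.

Lemma bruhat_apm_of_face w Z : face_apm (ideal_faces w) (Some Z) ->
  bruhat_apm (B v :&: B w) (Some (phi Z)).
Proof.
rewrite -phi_ideal => H; apply: (apm_imset (o := Some Z) _ _ _ H).
- by move=> S S'; rewrite !inE => /andP [sub _] /andP [sub' _]; rewrite phi_le.
- by move=> S; rewrite !inE => /andP [sub _]; rewrite len_phi.
- move=> S S'; rewrite !inE => /andP [sub _] /andP [sub' _] E.
  by rewrite -(support_phi sub) E support_phi.
Qed.

(** All nonfaces that are runs, minimal or not; [not_le_run] finds one inside every nonface. *)
Definition bad_runs w : seq {set 'I_n} :=
  [seq F <- enum (powerset (letters s)) | is_run (restrict s F) && ~~ bruhat_le (phi F) w].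

Lemma ideal_facesE w : ideal_faces w = avoiding (letters s) (bad_runs w).
Proof.
apply/setP => S; rewrite inE; apply/andP/avoidingP => -[sub H]; split=> //.
  move=> F; rewrite mem_filter mem_enum powersetE => /andP [/andP [_ nle] subF].
  by apply: contra nle => FS; apply: bruhat_trans H; rewrite phi_le.
apply/negPn/negP => nle.
have ur : uniq (restrict s S) by rewrite filter_uniq.
have [r [r1 r2 r3]] := not_le_run ur nle.
have rs := subseq_trans r2 (restrict_subseq s S).
have rE := restrict_letters vs us rs.
have sr : letters r \subset letters s by apply: letters_sub.
have /H /negP : letters r \in bad_runs w.
  by rewrite mem_filter mem_enum powersetE sr andbT /phi rE r1 r3.
by case; rewrite -(letters_restrict sub); apply: letters_sub.
Qed.

Lemma unmatched_cover w z : bruhat_apm (B v :&: B w) (Some z) ->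
  exists Gs : seq {set 'I_n},
  [/\ all (fun G => is_run (restrict s G)) Gs, size Gs + len z = size s
    & letters s \subset \bigcup_(G <- Gs) G].
Proof.
move=> H; have zv := apm_unmatched_in H.
have := face_apm_of_bruhat H; rewrite ideal_facesE => /apm_avoiding_cover.
case; first by apply/allP => F; rewrite mem_filter mem_enum powersetE => /andP [].
move=> Gs [/mem_subseq sub sz cov]; exists Gs; split=> //.
  by apply/allP => G /sub; rewrite mem_filter => /andP [/andP []].
move: zv; rewrite inE => /andP []; rewrite inE => /phi_support [sz' Ez] _.
by rewrite -Ez len_phi // sz card_letters.
Qed.

End Boolean.
End Words.

(** * Run decompositions from covers by runs *)

Section Runs.
Variable n : nat.
Implicit Types (s t r : seq nat) (c d : nat).

Lemma st_comm c d : c.+1 < d -> (st n c * st n d = st n d * st n c)%g.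
Proof.
move=> cd; case: (boolP (0 < c < n)) => [Hc|/st_out ->]; last by rewrite mulg1 mul1g.
case: (boolP (0 < d < n)) => [Hd|/st_out ->]; last by rewrite mulg1 mul1g.
apply/permP => x; apply: val_inj; rewrite /= !permM !val_st //.
do ![case: eqP]; lia.
Qed.

Definition far c d := (c.+1 < d) || (d.+1 < c).

Lemma st_far c d : far c d -> (st n c * st n d = st n d * st n c)%g.
Proof. by case/orP => /st_comm. Qed.

Lemma word_perm_far c s t : all (far c) s ->
  word_perm n (c :: s ++ t) = word_perm n (s ++ c :: t).
Proof.
elim: s => [|d s IH] //= /andP [cd Hs].
by rewrite -IH //= -!mulgA (st_far cd).
Qed.

(** Bringing the letters in [P] to the front only exchanges a letter outside [P] with a later one in
    [P]. *)
Lemma word_perm_split (P : pred nat) s :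
  (forall c d, subseq [:: c; d] s -> ~~ P c -> P d -> far c d) ->
  word_perm n s = word_perm n (filter P s ++ filter (predC P) s).
Proof.
elim: s => [|c s IH] //= H.
have {}IH : word_perm n s = word_perm n (filter P s ++ filter (predC P) s).
  by apply: IH => d e sub; apply: H; case: eqP => // _; apply: subseq_trans sub; apply: subseq_cons.
case: (boolP (P c)) => Pc /=; first by rewrite IH.
rewrite -word_perm_far /= -?IH //.
apply/allP => d; rewrite mem_filter => /andP [Pd ds].
by apply: (H c d) => //; rewrite eqxx sub1seq.
Qed.

Lemma subseq2_asym s c d : uniq s -> subseq [:: c; d] s -> ~~ subseq [:: d; c] s.
Proof.
elim: s => //= e s IH /andP [es us].
case: (eqVneq c e) => [->|ce].
  rewrite sub1seq => ds; case: (eqVneq d e) => [E|_]; first by rewrite E (negbTE es) in ds.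
  by apply: contra es => /mem_subseq; apply; rewrite !inE eqxx orbT.
move=> sub; case: (eqVneq d e) => [E|_]; last exact: IH.
by move: (mem_subseq sub) => /(_ d); rewrite !inE eqxx orbT => /(_ isT); rewrite E (negbTE es).
Qed.

Lemma is_runP r : reflect (exists a m, r = iota a m.+1 \/ r = rev (iota a m.+1)) (is_run r).
Proof.
apply: (iffP idP) => [|[a [m [->|->]]]];
  [|exact: is_run_iota|by rewrite is_run_rev is_run_iota].
case/andP; case: r => // c r _ /orP [/eqP E|/eqP E].
  by exists c, (size r); left.
by exists (last c r), (size r); right.
Qed.

Lemma filter_lt_iota a b m : filter (ltn^~ a) (iota b m) = iota b (minn m (a - b)).
Proof.
elim: m b => [|m IH] b; first by rewrite min0n.
rewrite /= IH; case: ltnP => [ba|ab].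
  by rewrite (_ : minn m.+1 (a - b) = (minn m (a - b.+1)).+1) //; lia.
have -> : minn m.+1 (a - b) = 0 by lia.
by have -> : minn m (a - b.+1) = 0 by lia.
Qed.

Lemma is_run_filter_lt a r : is_run r -> filter (ltn^~ a) r != [::] -> is_run (filter (ltn^~ a) r).
Proof.
case/is_runP => b [m [|] ->]; rewrite ?filter_rev filter_lt_iota.
  by case: (minn _ _) => // k _; apply: is_run_iota.
by case: (minn _ _) => // k _; rewrite is_run_rev is_run_iota.
Qed.

(* Peel off the run through the largest letter, trimming the other runs: all
   letters of the rest are smaller, so the two parts commute past each other up
   to the order of the two adjacent letters where they meet. *)
Lemma run_decomposition_of_cover s (Gs : seq (seq nat)) : uniq s ->
  all is_run Gs -> all (fun G => subseq G s) Gs ->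
  (forall c, c \in s -> has (fun G => c \in G) Gs) ->
  exists rs, [/\ all is_run rs, word_perm n (flatten rs) = word_perm n s,
    perm_eq (flatten rs) s & size rs <= size Gs].
Proof.
have [m] := ubnP (size Gs); elim: m s Gs => // m IH s Gs szG us runG subG cov.
case: (posnP (size s)) => [/size0nil ->|s0]; first by exists [::].
have [M Ms maxM] : exists2 M, M \in s & forall c, c \in s -> c <= M.
  case: s s0 {us subG cov} => // c s _; elim: s c => [|d s IHs] c.
    by exists c; rewrite ?inE // => d; rewrite inE => /eqP ->.
  have [M Ms maxM] := IHs d.
  case: (leqP c M) => cM; [exists M; first by rewrite inE Ms orbT|exists c; first by rewrite inE eqxx].
    by move=> e; rewrite inE => /orP [/eqP ->|/maxM].
  move=> e; rewrite inE => /orP [/eqP ->//|/maxM eM]; exact: leq_trans eM (ltnW cM).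
have /hasP [F FG MF] := cov M Ms.
have runF := allP runG F FG; have subF := allP subG F FG.
have [a [k [FE Ma]]] : exists a k, perm_eq F (iota a k.+1) /\ M = a + k.
  case/is_runP: runF => a [k FE]; exists a, k.
  have pF : perm_eq F (iota a k.+1) by case: FE => ->; rewrite ?perm_rev.
  split=> //; apply/eqP; rewrite eqn_leq; apply/andP; split.
    by move: MF; rewrite (perm_mem pF) mem_iota; lia.
  by apply: maxM; apply: (mem_subseq subF); rewrite (perm_mem pF) mem_iota; lia.
(* [F] ends at the maximum of [s], so it consists of all letters of [s] from [a] on. *)
have inF c : c \in s -> (c \in F) = (a <= c).
  by move=> /maxM cM; rewrite (perm_mem FE) mem_iota; lia.
have F_filter : F = filter (leq a) s.
  by rewrite {1}(subseq_uniqP us subF); apply: eq_in_filter => c /inF.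
pose s' := filter (ltn^~ a) s.
have s'E : s' = filter (predC (leq a)) s.
  by apply: eq_filter => c /=; rewrite ltnNge.
have F_filter' : F = filter (predC (ltn^~ a)) s.
  by rewrite F_filter; apply: eq_filter => c /=; rewrite -leqNgt.
(* Trimmed runs that become empty are discarded, because a run is nonempty. *)
pose Gs' := [seq G <- [seq filter (ltn^~ a) G | G <- rem F Gs] | G != [::]].
have szG' : size Gs' < size Gs.
  apply: leq_ltn_trans (size_subseq (filter_subseq _ _)) _.
  by rewrite size_map size_rem // prednK //; case: (Gs) FG.
have [|||||rs [rrs wrs prs szrs]] := IH s' Gs' _ _ _ _ _.
- exact: leq_trans szG' szG.
- by rewrite filter_uniq.
- apply/allP => G; rewrite mem_filter => /andP [G0 /mapP [H HG E]].
  by rewrite E in G0 *; apply: is_run_filter_lt => //; apply: (allP runG); apply: mem_rem HG.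
- apply/allP => G; rewrite mem_filter => /andP [G0 /mapP [H HG ->]].
  rewrite subseq_filter filter_all; apply: subseq_trans (filter_subseq _ _) _.
  by apply: (allP subG); apply: mem_rem HG.
- move=> c; rewrite mem_filter => /andP [ca cs].
  have /hasP [G GG cG] := cov c cs.
  have GF : G != F by apply: contraTneq cG => ->; rewrite inF // -ltnNge.
  have cG' : c \in filter (ltn^~ a) G by rewrite mem_filter ca.
  apply/hasP; exists (filter (ltn^~ a) G) => //.
  rewrite mem_filter; apply/andP; split; first by apply: contraTneq cG' => ->.
  apply/mapP; exists G => //; move: GG; rewrite (perm_mem (perm_to_rem FG)) inE.
  by rewrite (negbTE GF).
have szF : (size rs).+1 <= size Gs by apply: leq_trans szG'; rewrite ltnS.
have pFs : perm_eq (F ++ flatten rs) s.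
  apply: (@perm_trans _ (F ++ s')); first by rewrite perm_cat2l.
  by rewrite F_filter s'E; apply/permPl; apply: perm_filterC.
(* Only [a.-1] and [a] fail to commute across the two parts, so their order in [s] decides whether
   [F] goes last or first. *)
case: (boolP (subseq [:: a.-1; a] s)) => ord.
- exists (rcons rs F); rewrite all_rcons runF size_rcons -cats1 flatten_cat /= cats0.
  split=> //; last by rewrite perm_catC.
  rewrite word_perm_cat wrs -word_perm_cat.
  rewrite [in LHS]F_filter' [in RHS](word_perm_split (P := ltn^~ a)) // => c d cd /=.
  rewrite -leqNgt => ac da; rewrite /far.
  apply: contraT => H.
  have [E1 E2] : c = a /\ d = a.-1 by move: H ac da; clear; lia.
  by have := subseq2_asym us cd; rewrite E1 E2 ord.
- exists (F :: rs); rewrite /= runF; split=> //.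
  rewrite word_perm_cat wrs -word_perm_cat.
  rewrite [in LHS]F_filter s'E [in RHS](word_perm_split (P := leq a)) // => c d cd /=.
  rewrite -ltnNge => ca ad; rewrite /far.
  apply: contraT => H.
  have [E1 E2] : c = a.-1 /\ d = a by move: H ca ad; clear; lia.
  by case/negP: ord; rewrite -E1 -E2.
Qed.

End Runs.

(** * The word of the partner *)

Section PartnerWord.
Variable n : nat.
Implicit Types (s t r : seq nat) (rs : seq (seq nat)) (c d : nat) (S : {set 'I_n}).

Lemma tword_iota a m : tword (iota a m.+2) = iota a.+1 m.+1 ++ iota a m.+1.
Proof. by rewrite /tword /inc_run /= size_iota eqxx. Qed.

(** Makes the decreasing case the inverse of the increasing one. *)
Lemma tword_rev_iota a m : tword (rev (iota a m.+1)) = rev (tword (iota a m.+1)).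
Proof.
case: m => [//|m]; set r := rev _.
have r_size : size r = m.+2 by rewrite size_rev size_iota.
have r_last : last 0 r = a by rewrite /r /= rev_cons last_rcons.
have r_head : head 0 r = a + m.+1 by rewrite /r -[m.+2]addn1 iotaD rev_cat.
have -> : tword r = rev (iota a m.+1) ++ rev (iota a.+1 m.+1).
  rewrite /tword r_size r_last /=; case: ifP => // /eqP E.
  have : a \in r by rewrite mem_rev mem_iota; lia.
  by rewrite E r_head mem_iota; lia.
by rewrite tword_iota rev_cat.
Qed.

Lemma mem_tword c r : is_run r -> c \in tword r -> c \in r.
Proof.
have H a m : c \in tword (iota a m.+1) -> c \in iota a m.+1.
  by case: m => [//|m]; rewrite tword_iota mem_cat !mem_iota; lia.
case/is_runP => a [m [|] ->]; first exact: H.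
by rewrite tword_rev_iota !mem_rev; apply: H.
Qed.

Lemma word_iota i m (k : 'I_n) : 0 < i -> k.+1 = i + m ->
  word_perm n (iota i m) k = i.-1 :> nat.
Proof.
elim: m i => [|m IH] i i0 ki /=; first by rewrite perm1; lia.
rewrite permM val_st; last by have := ltn_ord k; lia.
by rewrite IH; [do ![case: eqP]; lia|lia|lia].
Qed.

Lemma word_perm_fix t (k : 'I_n) : (k : nat) \notin t -> k.+1 \notin t -> word_perm n t k = k.
Proof.
move=> kt k1t; apply: val_inj => /=.
by have := word_perm_ltn k kt; have := word_perm_ltn k k1t; lia.
Qed.

(* Writing the word from right to left, the part [t] already written carries the
   largest moved point [K] to the next letter [c], so [c] creates an inversion. *)
Lemma tight_tword_iota a m : 0 < a -> a + m < n -> tight n (tword (iota a m.+1)).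
Proof.
case: m => [_ _|m a0 amn]; first by apply: tight_uniq.
(* [j] counts the letters of the first block, taken from its end, already placed before the second
   block. *)
have tw j : j <= m.+1 -> tight n (iota (a + m.+2 - j) j ++ iota a m.+1).
  elim: j => [_|j IH jm].
    apply: tight_uniq; rewrite ?iota_uniq //; apply/allP => c; rewrite mem_iota; lia.
  have -> : iota (a + m.+2 - j.+1) j.+1 = a + m.+2 - j.+1 :: iota (a + m.+2 - j) j.
    by rewrite /= (_ : (a + m.+2 - j.+1).+1 = a + m.+2 - j) //; lia.
  set c := a + m.+2 - j.+1.
  apply: tight_cons => [||x y Hx Hy]; [by rewrite /c; lia|by apply: IH; lia|].
  pose t := iota (a + m.+2 - j) j ++ iota a m.+1; rewrite -/t.
  pose K := Ordinal amn.
  have tK : word_perm n t K = y.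
    apply: val_inj; rewrite /t word_perm_cat permM.
    rewrite (@word_perm_fix (iota a m.+1) K); try by rewrite mem_iota /=; lia.
    by rewrite /= word_iota /=; rewrite ?Hy /c; lia.
  have -> : ((word_perm n t)^-1)%g y = K by rewrite -tK permK.
  have K1 : K.+1 \notin t by rewrite /t mem_cat !mem_iota /=; lia.
  have := word_permV_ltn x K1; rewrite ltnS [in RHS]ltnS.
  rewrite leq_eqVlt => H.
  have : x <= K by rewrite /= Hx /c; lia.
  rewrite -H => /orP [/eqP/val_inj E|//].
  have : word_perm n t K = x by rewrite -E permKV.
  by rewrite tK => Exy; move: Hy; rewrite Exy Hx /c; lia.
rewrite tword_iota; have := tw m.+1 (leqnn _).
by rewrite (_ : a + m.+2 - m.+1 = a.+1) //; lia.
Qed.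

Lemma tight_tword r : is_run r -> valid_word n r -> tight n (tword r).
Proof.
have H a m : valid_word n (iota a m.+1) -> tight n (tword (iota a m.+1)).
  move=> /allP vr; apply: tight_tword_iota.
    by have /andP [] := vr a (mem_head _ _).
  by have /andP [] : 0 < a + m < n by apply: vr; rewrite mem_iota; lia.
case/is_runP => a [m [|] ->]; first exact: H.
by rewrite /valid_word all_rev tword_rev_iota => /H; apply: tight_rev.
Qed.

Lemma valid_tword r : is_run r -> valid_word n r -> valid_word n (tword r).
Proof. by move=> rr /allP H; apply/allP => c /(mem_tword rr) /H. Qed.

Lemma uniq_flatten_disjoint r rs r' c : uniq (flatten (r :: rs)) -> r' \in rs ->
  c \in r -> c \notin r'.
Proof.
rewrite /= cat_uniq => /and3P [_ /hasPn H _] r'rs cr.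
apply: contraL cr => cr'; apply: H; apply/flattenP; exists r' => //.
Qed.

Lemma tight_twords rs : all is_run rs -> valid_word n (flatten rs) -> uniq (flatten rs) ->
  tight n (flatten (map tword rs)).
Proof.
elim: rs => [_ _ _|r rs IH] /=; first exact: tight_uniq.
move=> /andP [rr rrs]; rewrite /valid_word all_cat => /andP [vr vrs] us.
have := us; rewrite cat_uniq => /and3P [ur _ urs].
apply: tight_cat; [exact: valid_tword|exact: tight_tword|exact: IH|].
move=> c /(mem_tword rr) cr; apply/flattenP => -[_ /mapP [r' r'rs ->]].
move=> /(mem_tword (allP rrs _ r'rs)) cr'.
by have := uniq_flatten_disjoint us r'rs cr; rewrite cr'.
Qed.

Lemma word_perm_comm s t : (forall c d, c \in s -> d \in t -> far c d) ->
  word_perm n (s ++ t) = word_perm n (t ++ s).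
Proof.
elim: s => [|c s IH] H /=; first by rewrite cats0.
rewrite IH; last by move=> d e ds; apply: H; rewrite inE ds orbT.
rewrite -word_perm_far //; apply/allP => d; apply: H; exact: mem_head.
Qed.

Lemma restrict_rev r S : restrict (rev r) S = rev (restrict r S).
Proof. exact: filter_rev. Qed.

(* Once the letter [d] is dropped, the letters above it can be moved in front
   of those below it, which gives a subword of [tword r]. *)
Lemma tword_missing_letter r d S : is_run r -> d \in r -> d \notin [seq val x | x in S] ->
  exists2 t, subseq t (tword r) & word_perm n t = word_perm n (restrict r S).
Proof.
have H a m : d \in iota a m.+1 -> d \notin [seq val x | x in S] ->
    exists2 t, subseq t (tword (iota a m.+1)) & word_perm n t = word_perm n (restrict (iota a m.+1) S).
  rewrite mem_iota => /andP [ad dam] dS.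
  have -> : restrict (iota a m.+1) S =
      restrict (iota a (d - a)) S ++ restrict (iota d.+1 (a + m - d)) S.
    have -> : iota a m.+1 = iota a (d - a) ++ d :: iota d.+1 (a + m - d).
      rewrite -[d :: _]/(iota d (a + m - d).+1) -{2}(subnKC ad) -iotaD.
      by congr iota; lia.
    by rewrite /restrict filter_cat /= (negbTE dS).
  exists (restrict (iota d.+1 (a + m - d)) S ++ restrict (iota a (d - a)) S); last first.
    apply/esym/word_perm_comm => c e; rewrite !mem_filter !mem_iota /far; lia.
  case: m dam => [|m] dam.
    have -> : d = a by lia.
    by rewrite addn0 subnn.
  rewrite tword_iota; apply: cat_subseq; apply: subseq_trans (restrict_subseq _ _) _.
    have -> : iota a.+1 m.+1 = iota a.+1 (d - a) ++ iota d.+1 (a + m.+1 - d).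
      have -> : d.+1 = a.+1 + (d - a) by lia.
      by rewrite -iotaD; congr iota; lia.
    exact: suffix_subseq.
  have -> : iota a m.+1 = iota a (d - a) ++ iota d (a + m.+1 - d).
    have {2}-> : d = a + (d - a) by lia.
    by rewrite -iotaD; congr iota; lia.
  exact: prefix_subseq.
case/is_runP => a [m [|] ->]; first exact: H.
rewrite mem_rev => da dS; have [t t1 t2] := H a m da dS.
exists (rev t); first by rewrite tword_rev_iota subseq_rev.
by rewrite restrict_rev !word_perm_rev t2.
Qed.

Lemma twords_missing_letters rs S : all is_run rs ->
  (forall r, r \in rs -> exists2 d, d \in r & d \notin [seq val x | x in S]) ->
  exists2 t, subseq t (flatten (map tword rs)) &
    word_perm n t = word_perm n (restrict (flatten rs) S).
Proof.
elim: rs => [|r rs IH] /=; first by exists [::].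
move=> /andP [rr rrs] H.
have [|t t1 t2] := IH rrs; first by move=> r' r'rs; apply: H; rewrite inE r'rs orbT.
have [d dr dS] := H r (mem_head _ _).
have [t' t'1 t'2] := tword_missing_letter rr dr dS.
exists (t' ++ t); first exact: cat_subseq.
by rewrite /restrict filter_cat !word_perm_cat t2 t'2.
Qed.

Lemma subseq_cons_catr c s t1 t2 : c \notin t1 ->
  subseq (c :: s) (t1 ++ t2) -> subseq (c :: s) t2.
Proof.
elim: t1 => // d t1 IH; rewrite inE negb_or => /andP [cd ct] /=.
by rewrite (negbTE cd); apply: IH.
Qed.

(** The letter [a] occurs only in the second block, which lacks the last letter of the run. *)
Lemma not_subseq_tword r : is_run r -> ~~ subseq r (tword r).
Proof.
have H a m : ~~ subseq (iota a m.+1) (tword (iota a m.+1)).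
  case: m => [//|m]; rewrite tword_iota; apply/negP.
  move=> /(subseq_cons_catr (s := iota a.+1 m.+1)); rewrite mem_iota ltnn => /(_ isT).
  by move=> /mem_subseq /(_ (a + m.+1)); rewrite in_cons !mem_iota; lia.
case/is_runP => a [m [|] ->]; first exact: H.
by rewrite tword_rev_iota subseq_rev.
Qed.

Lemma filter_twords rs r : all is_run rs -> uniq (flatten rs) -> r \in rs ->
  filter [in r] (flatten (map tword rs)) = tword r.
Proof.
elim: rs => //= r0 rs IH /andP [rr0 rrs] us; rewrite inE filter_cat.
have dis r' : r' \in rs -> forall c, c \in r0 -> c \notin r'.
  by move=> r'rs c cr; apply: uniq_flatten_disjoint us r'rs cr.
case: eqP => [-> _|_ /= rrs'].
  have -> : [seq x <- tword r0 | x \in r0] = tword r0.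
    by apply/all_filterP/allP => c; apply: mem_tword.
  have /eqP -> : [seq x <- flatten (map tword rs) | x \in r0] == [::]; last by rewrite cats0.
  rewrite -[_ == _]negbK -has_filter; apply/hasPn => c /flattenP [_ /mapP [r' r'rs ->]].
  move=> /(mem_tword (allP rrs _ r'rs)) cr'; apply/negP => cr.
  by have := dis r' r'rs c cr; rewrite cr'.
have := us; rewrite cat_uniq => /and3P [_ _ urs].
rewrite IH //; have /eqP -> // : [seq x <- tword r0 | x \in r] == [::].
rewrite -[_ == _]negbK -has_filter; apply/hasPn => c /(mem_tword rr0) cr0.
exact: dis cr0.
Qed.

(** A decreasing run has a positive rank entry, which by [crossing_subword] only a word containing
    the run can have; increasing runs follow by inversion. *)
Lemma run_le_subseq r t : is_run r -> valid_word n r ->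
  bruhat_le (word_perm n r) (word_perm n t) -> subseq r t.
Proof.
have H a m t' : valid_word n (iota a m.+1) ->
    bruhat_le (word_perm n (rev (iota a m.+1))) (word_perm n t') -> subseq (rev (iota a m.+1)) t'.
  move=> /allP vr le.
  have /andP [a0 _] := vr a (mem_head _ _).
  have /andP [_ amn] : 0 < a + m < n by apply: vr; rewrite mem_iota; lia.
  have := dec_run_Rk a0 (leq_addr m a) amn; rewrite addKn.
  move=> /(bruhat_Rk_gt0 le) /Rk_gt0P [k k1 k2].
  by have := crossing_subword k1 (leq_addr m a) k2; rewrite addKn.
case/is_runP => a [m [|] ->]; last by rewrite /valid_word all_rev; apply: H.
move=> vr; rewrite -bruhat_leVE -!word_perm_rev => /(H _ _ _ vr).
by rewrite subseq_rev.
Qed.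

(** A set missing a letter of each run gives a product of subwords of the [tword r]. A face
    containing [r] would force [r] into the partner's word, and, filtered to its own letters, into
    [tword r]. *)
Lemma ideal_faces_twords rs : all is_run rs -> valid_word n (flatten rs) -> uniq (flatten rs) ->
  ideal_faces (flatten rs) (word_perm n (flatten (map tword rs))) =
  avoiding (letters n (flatten rs)) (map (letters n) rs).
Proof.
move=> rrs vs us; set s := flatten rs.
apply/setP => S; rewrite inE; apply/andP/avoidingP => -[sub H]; split=> //.
  move=> _ /mapP [r rin ->]; apply/negP => rS.
  have rr := allP rrs r rin.
  have rsub : subseq r s.
    by rewrite /s; move: rin; elim: (rs) => //= r0 rs' IH; rewrite inE =>
      /orP [/eqP ->|/IH H']; [exact: prefix_subseq|exact: subseq_trans (suffix_subseq _ _)].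
  have vr := subseq_valid rsub vs.
  have le : bruhat_le (word_perm n r) (word_perm n (flatten (map tword rs))).
    apply: bruhat_trans H; rewrite -{1}(restrict_letters vs us rsub).
    by rewrite phi_le // letters_sub.
  have := run_le_subseq rr vr le => sub'.
  case/negP: (not_subseq_tword rr); rewrite -(filter_twords rrs us rin).
  by rewrite subseq_filter sub' andbT; apply/allP.
have [|t t1 t2] := @twords_missing_letters rs S rrs.
  move=> r rin; have : ~~ (letters n r \subset S) by apply: H; apply: map_f.
  case/subsetPn => c; rewrite inE => cr cS; exists (val c) => //.
  by rewrite mem_image_val.
rewrite -t2; apply: subword_le t1; exact: tight_twords.
Qed.

Lemma pairwise_letters rs : uniq (flatten rs) ->
  pairwise (fun F G : {set 'I_n} => [disjoint F & G]) (map (letters n) rs).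
Proof.
elim: rs => // r rs IH us; rewrite map_cons pairwise_cons.
have := us; rewrite /= cat_uniq => /and3P [_ _ /IH ->]; rewrite andbT.
apply/allP => _ /mapP [r' r'rs ->]; rewrite disjoints_subset; apply/subsetP => c.
by rewrite !inE => cr; apply: uniq_flatten_disjoint us r'rs cr.
Qed.

Lemma bigcup_letters rs : \bigcup_(F <- map (letters n) rs) F = letters n (flatten rs).
Proof.
apply/setP => c; rewrite in_bigcup_seq has_map inE.
apply/hasP/flattenP => -[r rin H]; exists r => //; by move: H; rewrite /= inE.
Qed.

End PartnerWord.

Theorem theorem5p14 (n : nat) (v : {perm 'I_n}) (rs : seq (seq nat)) :
  boolean v ->
  optimal_run_decomposition rs v ->
  let w := word_perm n (flatten (map tword rs)) in
  optimal_partner v w /\ is_ork v (len v - size rs).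
Proof.
move=> bv [[rrs [red vE]] opt] w.
have us : uniq (flatten rs) by apply: bv.
have vs : valid_word n (flatten rs) by case: red.
have lv : len v = size (flatten rs) by rewrite -vE -(tight_uniq vs us).
have [z Hz cz] : exists2 z, has_apm_with_unmatched (B v :&: B w) z & len z = len v - size rs.
  have [|Z HZ cZ] := apm_disjoint (pairwise_letters n us).
    apply/allP => _ /mapP [r rin ->]; have := allP rrs r rin; case: r rin => // c r rin _.
    have /andP [_ cn] : 0 < c < n.
      by apply: (allP vs); apply/flattenP; exists (c :: r); rewrite ?mem_head.
    by apply/set0Pn; exists (Ordinal cn); rewrite inE mem_head.
  rewrite bigcup_letters size_map card_letters // -lv in HZ cZ.
  rewrite -ideal_faces_twords // in HZ.
  have := bruhat_apm_of_face vs us HZ; rewrite vE => /has_apmP Hz.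
  exists (word_perm n (restrict (flatten rs) Z)) => //.
  have : Z \in ideal_faces (flatten rs) w by apply: apm_unmatched_in HZ.
  by rewrite inE => /andP [sub _]; rewrite len_phi // -cZ addnK.
have ork : is_ork v (len v - size rs).
  split; first by exists w, z.
  move=> w' z' /has_apmP; rewrite -{1}vE => /(unmatched_cover vs us) [Gs [rGs szGs cov]].
  have [||c cs|rs' [rrs' wrs' prs' szrs']] :=
      @run_decomposition_of_cover n (flatten rs) [seq restrict (flatten rs) G | G <- Gs] us.
  - by rewrite all_map.
  - by apply/allP => _ /mapP [G _ ->]; apply: restrict_subseq.
  - have /andP [_ cn] := allP vs c cs.
    have : Ordinal cn \in letters n (flatten rs) by rewrite inE.
    move/(subsetP cov); rewrite in_bigcup_seq has_map => /hasP [G GG cG].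
    apply/hasP; exists G => //=; rewrite mem_filter cs andbT.
    by rewrite -[c]/(val (Ordinal cn)) mem_image_val.
  have vrs' : valid_word n (flatten rs') by rewrite /valid_word (perm_all _ prs').
  have urs' : uniq (flatten rs') by rewrite (perm_uniq prs').
  have dec : run_decomposition rs' v.
    by split=> //; split; [apply/reducedP => //; apply: tight_uniq|rewrite wrs'].
  (* Optimality enters here: [size rs <= size rs' <= size Gs = len v - len z']. *)
  have := opt rs' dec; rewrite size_map in szrs'; rewrite lv; lia.
split=> //; exists (len v - size rs); split=> //.
by exists z.
Qed.
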